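(* Consider a sequence of Ising neighborhood selection problems indexed by the sample size $n$: in the $n$-th problem, $Z_1,\dots,Z_n$ is an i.i.d. sample of random vectors in $\{-1,1\}^{p_n}$ following the Ising model with interaction parameters $\theta_{vw}(n)$, edge set $E(n)$ and neighborhoods $\mathrm{ne}_n(v)$, $v\in[p_n]$. Let $d_n=\max_{v\in[p_n]}|\mathrm{ne}_n(v)|$, let $\theta_{\min}(n)=\min_{\{v,w\}\in E(n)}|\theta_{vw}(n)|$, and let $q_n\ge1$ be integers. Suppose that $p_n\to\infty$ as $n\to\infty$ with $p_n\le n^\kappa$ for some $\kappa\in(0,\infty]$ and $\log(p_n)\le n^\tau$ for some $0<\tau<1$. Suppose further that $q_n\le n^\psi$ for some $0\le\psi<\frac13(1-\tau)$, and that $\theta_{\min}(n)\ge n^{-\phi/2}$ for some $0\le\phi<1-\psi-\tau$. Assume that $d_n\le q_n$ and that there are fixed constants $b_0,b_1,b_2>0$ (not depending on $n$) such that for every $n$: (B1) $\sqrt{\sum_{w\in\mathrm{ne}_n(v)}\theta_{vw}(n)^2}\le b_0$ for all $v\in[p_n]$; (B2) $\mathbb{E}[(Z_1^\top u)^2]\ge b_1$ for every $2q_n$-sparse unit vector $u\in\mathbb{R}^{p_n}$; (B3) $\mathbb{E}[|Z_1^\top u|^3]\le b_2$ for every $2q_n$-sparse unit vector $u\in\mathbb{R}^{p_n}$. Then for any $\gamma\ge 0$ with $\gamma>2-\frac1{2\kappa}$, Ising neighborhood selection with $\mathrm{BIC}_\gamma$ is consistent in the sense that the event that, simultaneously for all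 $v\in[p_n]$, $$\mathrm{ne}_n(v)=\arg\min\{\mathrm{BIC}_\gamma(J,v): J\subset[p_n]\setminus\{v\},\ |J|\le q_n\}$$ (i.e. $\mathrm{ne}_n(v)$ is the unique minimizer) has probability tending to one as $n\to\infty$.
   Context: $[p]=\{1,\dots,p\}$; a vector is $k$-sparse if it has at most $k$ nonzero coordinates; a unit vector has Euclidean norm $1$. When $\kappa=\infty$, the condition $p_n\le n^\kappa$ is vacuous and $\frac1{2\kappa}=0$. A minimum over the empty set is read as $+\infty$. Ising model: for an undirected graph $G=([p],E)$ and real interaction parameters $\theta_{vw}=\theta_{wv}$, a random vector $Z$ with values in $\{-1,1\}^p$ has $P(Z=z)\propto\exp\{\sum_{\{v,w\}\in E}\theta_{vw}z_vz_w\}$. The graph is assumed minimal: $\{v,w\}\in E$ if and only if $\theta_{vw}\ne0$. The neighborhood of $v$ is $\mathrm{ne}(v)=\{w\in[p]\setminus\{v\}:\{v,w\}\in E\}$. Conditionally on the other coordinates, the log-odds of $Z_v=1$ equal $\sum_{w\in\mathrm{ne}(v)}2\theta_{vw}z_w$. Nodewise criterion: write $Z_i=(Z_{i1},\dots,Z_{ip})$. For $v\in[p]$ and $J\subseteq[p]\setminus\{v\}$, consider the logistic regression with responses $Y_i=(Z_{iv}+1)/2\in\{0,1\}$ and covariates $Z_{iw}$, $w\in J$, whose log-likelihood is $\ell_{J,v}(\beta)=\sum_{i=1}^n\big[Y_i\sum_{w\in J}\beta_wZ_{iw}-\log\big(1+e^{\sum_{w\in J}\beta_wZ_{iw}}\big)\big]$,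 $\beta\in\mathbb{R}^J$. Then, for $\gamma\ge 0$, $\mathrm{BIC}_\gamma(J,v)=-2\sup_{\beta\in\mathbb{R}^J}\ell_{J,v}(\beta)+|J|\big(\log(n)+2\gamma\log(p)\big)$, where the supremum is the value at the maximum likelihood estimator, and $p=p_n$ in the $n$-th problem. *)

(* Defs.v *)
From HB Require Import structures.
From mathcomp Require Import all_boot all_order all_algebra.
From mathcomp Require Import all_classical all_reals all_analysis.
Import Order.TTheory GRing.Theory Num.Theory.
Import numFieldNormedType.Exports.

Set Implicit Arguments.
Unset Strict Implicit.
Unset Printing Implicit Defensive.

Local Open Scope classical_set_scope.
Local Open Scope ring_scope.

(* [config p] encodes {-1,1}^p: [true] stands for +1 and [false] for -1. *)
Definition config (p : nat) := {ffun 'I_p -> bool}.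

Definition spin (R : realType) (p : nat) (z : config p) (v : 'I_p) : R :=
  if z v then 1 else -1.

(* The diagonal entries [inter v v] are unconstrained and never used. *)
Record ising_model (R : realType) (p : nat) := IsingModel {
  edge : rel 'I_p ;
  inter : 'I_p -> 'I_p -> R ;
  edge_sym : symmetric edge ;
  edge_irr : irreflexive edge ;
  inter_sym : forall v w, inter v w = inter w v ;
  edge_minimal : forall v w, v != w -> edge v w = (inter v w != 0)
}.

Section Ising.
Variables (R : realType) (p : nat) (M : ising_model R p).

Definition ne (v : 'I_p) : {set 'I_p} := [set w | edge M v w]%SET.

Definition max_degree : nat := \max_(v < p) #|ne v|.

(* The minimum over an empty edge set is +oo. *)
Definition theta_min : \bar R :=
  \big[Order.min/+oo%E]_(e : 'I_p * 'I_p | edge M e.1 e.2)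
    `|inter M e.1 e.2|%:E.

(* Each undirected edge {v, w} is represented once, by the pair with v < w. *)
Definition ising_weight (z : config p) : R :=
  expR (\sum_(v < p) \sum_(w < p | (v < w)%N && edge M v w)
          inter M v w * spin R z v * spin R z w).

Definition ising_pmf (z : config p) : R :=
  ising_weight z / \sum_(z' : config p) ising_weight z'.

(* Z_1, ..., Z_n are measurable, each with the Ising distribution, and
   mutually independent. Some A i may be the full set, so the product rule
   covers all subfamilies. *)
Definition ising_sample (d : measure_display) (T : measurableType d)
    (P : probability T R) (n : nat) (Z : 'I_n -> T -> config p) : Prop :=
  [/\ forall i z, measurable [set t | Z i t = z],
      forall i z, P [set t | Z i t = z] = (ising_pmf z)%:E
    & forall A : 'I_n -> {set config p},
        P [set t | forall i, Z i t \in A i] =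
        (\prod_(i < n) P [set t | Z i t \in A i])%E].

End Ising.

Section Vectors.
Variables (R : realType) (p : nat).

Definition dot (z : config p) (u : 'rV[R]_p) : R :=
  \sum_(w < p) spin R z w * u 0 w.

Definition sparse (k : nat) (u : 'rV[R]_p) : bool :=
  (#|[set w : 'I_p | u 0%R w != 0%R]%SET| <= k)%N.

(* The library norm on row vectors is the sup norm. *)
Definition euclidean_norm (u : 'rV[R]_p) : R :=
  Num.sqrt (\sum_(w < p) u 0 w ^+ 2).

End Vectors.

Section Criterion.
Variables (R : realType) (p n : nat) (z : 'I_n -> config p).

(* Only the coordinates of [beta] in J matter, so letting [beta] range over
   R^p gives the same set of values as letting it range over R^J. *)
Definition loglik (J : {set 'I_p}) (v : 'I_p) (beta : 'I_p -> R) : R :=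
  \sum_(i < n)
    let eta := \sum_(w in J) beta w * spin R (z i) w in
    ((spin R (z i) v + 1) / 2) * eta - ln (1 + expR eta).

(* The log-likelihood is bounded above by 0, so [sup] is a true supremum. *)
Definition BIC (gamma : R) (J : {set 'I_p}) (v : 'I_p) : R :=
  - 2 * sup (range (loglik J v))
  + #|J|%:R * (ln n%:R + 2 * gamma * ln p%:R).

Definition candidates (q : nat) (v : 'I_p) : {set {set 'I_p}} :=
  [set J : {set 'I_p} | (v \notin J) && (#|J| <= q)%N]%SET.

Definition is_unique_argmin (q : nat) (gamma : R) (v : 'I_p) (J0 : {set 'I_p})
    : Prop :=
  J0 \in candidates q v /\
  forall J, J \in candidates q v -> J != J0 -> BIC gamma J0 v < BIC gamma J v.

End Criterion.

(* For kappa in (0, +oo]: x^kappa, with x^(+oo) = +oo so that an upper bound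
   by it is vacuous, and 1/(2 kappa), with 1/(2 (+oo)) = 0. *)
Definition ext_powR (R : realType) (x : R) (kappa : \bar R) : \bar R :=
  if kappa is k%:E%E then (x `^ k)%:E else +oo%E.

Definition half_inv (R : realType) (kappa : \bar R) : R :=
  if kappa is k%:E%E then (2 * k)^-1 else 0.

(* Main.v *)
(* Conditionally on the other spins, the responses at a node v are independent
   Bernoulli variables whose log-odds are linear, with coefficients th supported
   on S = ne(v). A spin-covariate entry is bounded, so Hoeffding-type bounds give
   |score_j| <= C sqrt(n L) and an empirical Hessian close to its mean entrywise,
   L = log n + log p; on 2q-sparse vectors the Hessian is then of order n, and
   logistic self-concordance makes it stable along any short segment.

   A model J that misses a neighbour loses at least of order n theta_min^2 or n/q
   in log-likelihood, by concavity along the segment to th.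

   For J containing S, let D and DJ be the Newton steps from th over S and over J,
   and E = DJ - D. Expanding at th + D (and not at th, which would cost an error
   of order q) gives  sup_J l - l(th + D) <= (1 + o(1)) |E|_H^2 / 2 + o(L), where
   q^3 L / n -> 0 is what makes the remainders negligible. E is H-orthogonal to
   R^S, so |E|_H^2 / 2 behaves like a chi-square with k = |J \ S| degrees of
   freedom over 2: rounding its J \ S block to a grid of step n^(-1/2), and
   bounding the score in each H-projected grid direction by an exponential moment
   that is sharp up to 1 + o(1), a union bound with Gaussian weights exp(-s |m|^2)
   on the grid costs only C^k. Summing over nodes, J and the grid leaves
   p^2 exp(-(1 - dl) X / 2) with X = log n + 2 gamma log p, which tends to 0
   because gamma > 2 - 1/(2 kappa). *)
Require Import Defs.
From HB Require Import structures.
From mathcomp Require Import all_boot all_order all_algebra.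
From mathcomp Require Import all_classical all_reals all_analysis.
From mathcomp Require Import measurable_realfun ring lra.
Import Order.TTheory GRing.Theory Num.Theory.
Import numFieldNormedType.Exports.

Set Implicit Arguments.
Unset Strict Implicit.
Unset Printing Implicit Defensive.

Local Open Scope classical_set_scope.
Local Open Scope ring_scope.

(** The bound on [gamma] leaves no room in the leading constant, so |E|_H^2 / 2 needs a tail with
    its exact rate; cruder entrywise bounds serve only for curvature and remainders. But E depends
    on the responses, so no exponential moment applies to it directly. The grid replaces it by
    finitely many directions that are fixed once the spins off v are given: projecting a grid point
    on R^S involves only Hessian entries away from row and column v, and these do not see the spin
    at v. With mesh n^(-1/2) the squared H-length of the rounding error is at most a constant per
    coordinate of J \ S, negligible against log n. Conditional expectations are never formed.
    Resampling the spins at v preserves the finite product law, and this identity between finite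
    sums does the work of conditioning. *)

(** * The logistic function, its self-concordance and Taylor bounds *)

Section Logistic.
Variable R : realType.
Implicit Types x y a t : R.

Definition softplus x : R := ln (1 + expR x).
Definition sigm x : R := expR x / (1 + expR x).
Definition svar x : R := sigm x * (1 - sigm x).

Lemma onepexp_gt0 x : 0 < 1 + expR x.
Proof. by rewrite addr_gt0// expR_gt0. Qed.

Lemma svarE x : svar x = expR x / (1 + expR x) ^+ 2.
Proof. by rewrite /svar /sigm; have := onepexp_gt0 x => h; field; rewrite gt_eqF. Qed.

Lemma svar_gt0 x : 0 < svar x.
Proof. by rewrite svarE divr_gt0 ?expR_gt0 ?exprn_gt0 ?onepexp_gt0. Qed.

Lemma svar_le x : svar x <= 1 / 4.
Proof. by rewrite /svar; have := sqr_ge0 (sigm x - 1/2); nra. Qed.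

Lemma svar0 : svar 0 = 1 / 4.
Proof. by rewrite svarE expR0; field. Qed.

(** The derivative of ln [svar] is 1 - 2 sigm, of absolute value at most 1. This is the
    self-concordance of the logistic loss, checked here by algebra for each sign of a. *)
Lemma svar_shift_ge x a : svar x * expR (- `|a|) <= svar (x + a).
Proof.
have h1 := onepexp_gt0 x; have h2 := onepexp_gt0 (x + a).
have e0 := expR_gt0 x; have ea := expR_gt0 a.
rewrite !svarE ler_pdivlMr ?exprn_gt0//.
have -> : expR x / (1 + expR x) ^+ 2 * expR (- `|a|) * (1 + expR (x + a)) ^+ 2 =
  expR x * expR (- `|a|) * (1 + expR (x + a)) ^+ 2 / (1 + expR x) ^+ 2.
  by field; rewrite gt_eqF.
rewrite ler_pdivrMr ?exprn_gt0// expRD -!mulrA ler_pM2l//.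
have [a0|a0] := lerP 0 a.
- have ea1 : 1 <= expR a by rewrite -expR0 ler_expR.
  rewrite ger0_norm// expRN mulrC ler_pdivrMr//.
  have : 1 + expR x * expR a <= expR a * (1 + expR x) by nra.
  move=> h; have : (1 + expR x * expR a) ^+ 2 <= (expR a * (1 + expR x)) ^+ 2.
    rewrite ler_sqr // nnegrE; nra.
  by move/le_trans; apply; rewrite le_eqVlt; apply/orP; left; apply/eqP; ring.
- have ea1 : expR a <= 1 by rewrite -expR0 ler_expR ltW.
  rewrite ltr0_norm// opprK ler_pM2l//.
  rewrite ler_sqr ?nnegrE; nra.
Qed.

Lemma svar_shift_le x a : svar (x + a) <= svar x * expR `|a|.
Proof.
have := svar_shift_ge (x + a) (- a); rewrite addrK normrN => h.
by rewrite -ler_pdivrMr ?expR_gt0// -expRN.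
Qed.

Lemma is_derive_softplus x : is_derive x (1 : R) softplus (sigm x).
Proof.
have h := onepexp_gt0 x.
have -> : softplus = (@ln R) \o (fun y : R => 1 + expR y) by [].
have := is_derive1_ln h => H.
apply: is_derive_eq; rewrite /sigm ?add0r ?scaler1 /GRing.scale /=; ring.
Qed.

Lemma is_derive_sigm x : is_derive x (1 : R) sigm (svar x).
Proof.
have h := onepexp_gt0 x; have h0 : 1 + expR x != 0 by rewrite gt_eqF.
have -> : sigm = (fun y : R => expR y * (1 + expR y)^-1) by [].
have := is_deriveV h0 => H.
apply: is_derive_eq.
rewrite svarE /GRing.scale /= add0r; field; done.
Qed.

(** One mean value statement for both signs of a: [0 <= t * a] and [|t| <= |a|] together place t
    between 0 and a. *)
Lemma MVT_shift (f g : R -> R) x a : (forall y, is_derive y (1 : R) f (g y)) ->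
  exists t, [/\ 0 <= t * a, `|t| <= `|a| & f (x + a) - f x = a * g (x + t)].
Proof.
move=> fg; have cf : continuous f.
  by move=> y; apply/differentiable_continuous/derivable1_diffP; apply: ex_derive.
have [a0|a0|<-] := ltrgtP 0 a; last first.
- by exists 0; rewrite !addr0 subrr !mul0r; split.
- have xa : x + a <= x by lra.
  have [c /[!in_itv]/= /andP[c1 c2] h] := @MVT_segment R f g _ _ xa
    (fun y _ => fg y) (continuous_subspaceT cf).
  exists (c - x); split; first by nra.
    by rewrite !ler0_norm; lra.
  by rewrite subrKC; lra.
- have xa : x <= x + a by lra.
  have [c /[!in_itv]/= /andP[c1 c2] h] := @MVT_segment R f g _ _ xa
    (fun y _ => fg y) (continuous_subspaceT cf).
  exists (c - x); split; first by nra.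
    by rewrite !ger0_norm; lra.
  by rewrite subrKC; lra.
Qed.

Lemma sigm_taylor x a :
  `|sigm (x + a) - sigm x - a * svar x| <= svar x * (`|a| * (expR `|a| - 1)).
Proof.
have [t [_ ta ->]] := MVT_shift x a is_derive_sigm.
rewrite -mulrBr normrM mulrCA ler_wpM2l//.
have v0 := svar_gt0 x.
have h1 := svar_shift_le x t; have h2 := svar_shift_ge x t.
have h3 : expR `|t| <= expR `|a| by rewrite ler_expR.
(* As e^t + e^(-t) >= 2, [svar] can drop by no more than the bound for its increase, so one estimate
   serves both sides. *)
have h4 : 2 - expR `|t| <= expR (- `|t|).
  have EF : expR `|t| * expR (- `|t|) = 1 by rewrite -expRD subrr expR0.
  have : 0 <= expR (- `|t|) * (expR `|t| - 1) ^+ 2.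
    by rewrite mulr_ge0 ?sqr_ge0 ?expR_ge0.
  have -> : expR (- `|t|) * (expR `|t| - 1) ^+ 2 = (expR `|t| * expR (- `|t|)) * expR `|t|
    - 2 * (expR `|t| * expR (- `|t|)) + expR (- `|t|) by ring.
  by rewrite EF; lra.
have h5 : svar x * expR `|t| <= svar x * expR `|a| by rewrite ler_pM2l.
have h6 : svar x * (2 - expR `|t|) <= svar x * expR (- `|t|) by rewrite ler_pM2l.
by rewrite ler_norml; apply/andP; split; lra.
Qed.

Lemma softplus_taylor_le x a :
  softplus (x + a) - softplus x - a * sigm x <= svar x * expR `|a| * a ^+ 2 / 2.
Proof.
pose C := svar x * expR `|a|.
(* C bounds the curvature between x and x + a, so f' has the sign opposite to y - x there; two mean
   value steps replace the integral remainder. *)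
pose f y := softplus y - (y - x) * sigm x - C * (y - x) ^+ 2 / 2.
have df y : is_derive y (1 : R) f (sigm y - sigm x - C * (y - x)).
  have := is_derive_softplus y => h.
  by apply: is_derive_eq; rewrite /GRing.scale /=; field.
have [t [ta tla]] := MVT_shift x a df.
have [r [rt rlt]] := MVT_shift x t is_derive_sigm.
rewrite /f !subrr [x + a - x]addrAC subrr add0r [x + t - x]addrAC subrr add0r => E2 E1.
have : svar (x + r) <= C.
  apply: (le_trans (svar_shift_le x r)); rewrite ler_pM2l ?svar_gt0// ler_expR.
  exact: le_trans tla.
move=> h; have : a * (sigm (x + t) - sigm x - C * t) <= 0.
  by rewrite E2 [C * t]mulrC -mulrBr mulrA [a * t]mulrC mulr_ge0_le0// subr_le0.
move: E1; rewrite mul0r expr0n /= mulr0 mul0r !subr0 -/C; lra.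
Qed.

Lemma softplus_taylor_ge x a :
  svar x * expR (- `|a|) * a ^+ 2 / 2 <= softplus (x + a) - softplus x - a * sigm x.
Proof.
pose C := svar x * expR (- `|a|).
pose f y := softplus y - (y - x) * sigm x - C * (y - x) ^+ 2 / 2.
have df y : is_derive y (1 : R) f (sigm y - sigm x - C * (y - x)).
  have := is_derive_softplus y => h.
  by apply: is_derive_eq; rewrite /GRing.scale /=; field.
have [t [ta tla]] := MVT_shift x a df.
have [r [rt rlt]] := MVT_shift x t is_derive_sigm.
rewrite /f !subrr [x + a - x]addrAC subrr add0r [x + t - x]addrAC subrr add0r => E2 E1.
have : C <= svar (x + r).
  apply: le_trans (svar_shift_ge x r); rewrite ler_pM2l ?svar_gt0// ler_expR lerN2.
  exact: le_trans tla.
move=> h; have : 0 <= a * (sigm (x + t) - sigm x - C * t).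
  by rewrite E2 [C * t]mulrC -mulrBr mulrA [a * t]mulrC mulr_ge0// subr_ge0.
move: E1; rewrite mul0r expr0n /= mulr0 mul0r !subr0 -/C; lra.
Qed.

Lemma softplus_tangent x y : softplus x + (y - x) * sigm x <= softplus y.
Proof.
have := softplus_taylor_ge x (y - x); rewrite subrKC.
have := svar_gt0 x; have := expR_gt0 (- `|y - x|); have := sqr_ge0 (y - x).
move=> h1 h2 h3; have : 0 <= svar x * expR (- `|y - x|) * (y - x) ^+ 2 / 2.
  by rewrite divr_ge0// mulr_ge0// mulr_ge0// ltW.
lra.
Qed.

Lemma softplus_convex t x y : 0 <= t <= 1 ->
  softplus (x + t * (y - x)) <= (1 - t) * softplus x + t * softplus y.
Proof.
move=> /andP[t0 t1]; set m := x + _.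
have := softplus_tangent m x; have := softplus_tangent m y.
have : t * (y - m) + (1 - t) * (x - m) = 0 by rewrite /m; ring.
set s := sigm m; set b := softplus m.
move=> e h1 h2.
have h3 : t * (b + (y - m) * s) <= t * softplus y by rewrite ler_wpM2l.
have h4 : (1 - t) * (b + (x - m) * s) <= (1 - t) * softplus x by rewrite ler_wpM2l//; lra.
have : b = t * (b + (y - m) * s) + (1 - t) * (b + (x - m) * s).
  have -> : t * (b + (y - m) * s) + (1 - t) * (b + (x - m) * s) =
    b + (t * (y - m) + (1 - t) * (x - m)) * s by ring.
  by rewrite e mul0r addr0.
lra.
Qed.

Lemma svar_ge x : expR (- `|x|) / 4 <= svar x.
Proof. by have := svar_shift_ge 0 x; rewrite add0r svar0 mul1r mulrC. Qed.

End Logistic.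

Lemma cauchy_schwarz_sum (R : realType) (I : finType) (Q : pred I) (a b : I -> R) :
  (\sum_(i | Q i) a i * b i) ^+ 2 <=
  (\sum_(i | Q i) a i ^+ 2) * (\sum_(i | Q i) b i ^+ 2).
Proof.
set X := \sum_(i | Q i) a i * b i; set A := \sum_(i | Q i) a i ^+ 2.
set B := \sum_(i | Q i) b i ^+ 2.
have B0 : 0 <= B by apply: sumr_ge0 => i _; exact: sqr_ge0.
have h t : 0 <= A - 2 * t * X + t ^+ 2 * B.
  have -> : A - 2 * t * X + t ^+ 2 * B = \sum_(i | Q i) (a i - t * b i) ^+ 2.
    rewrite /A /B /X !mulr_sumr -sumrN -!big_split /=.
    by apply: eq_bigr => i _; ring.
  by apply: sumr_ge0 => i _; exact: sqr_ge0.
have [B00|Bn0] := eqVneq B 0.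
  have hz i : Q i -> b i = 0.
    move=> Qi; apply/eqP; rewrite -sqrf_eq0; move/eqP: B00.
    rewrite psumr_eq0; last by move=> j _; exact: sqr_ge0.
    by move/allP/(_ i); rewrite mem_index_enum Qi; apply.
  by rewrite /X big1 ?expr0n /= ?B00 ?mulr0// => i /hz ->; rewrite mulr0.
have Bp : 0 < B by rewrite lt_neqAle eq_sym Bn0.
rewrite -subr_ge0; have := mulr_ge0 B0 (h (X / B)).
suff -> : B * (A - 2 * (X / B) * X + (X / B) ^+ 2 * B) = A * B - X ^+ 2 by [].
by field.
Qed.

(** * Quadratic forms restricted to coordinate subspaces *)

Section QuadraticForms.
Variables (R : realType) (p : nat).
Implicit Types (H : 'M[R]_p) (u w g : 'rV[R]_p) (J : {set 'I_p}).

Definition bil H u w : R := (u *m H *m w^T) 0 0.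

Definition sqn u : R := \sum_j u 0 j ^+ 2.

Definition supported J u : Prop := forall j, j \notin J -> u 0 j = 0.

Definition vmask J u : 'rV[R]_p := \row_j (if j \in J then u 0 j else 0).

Lemma vmask_supported J u : supported J (vmask J u).
Proof. by move=> j jJ; rewrite mxE (negbTE jJ). Qed.

Lemma supportedS J J' u : J \subset J' -> supported J u -> supported J' u.
Proof. by move=> /fintype.subsetP s h j jJ; apply: h; apply: contra jJ; apply: s. Qed.

Lemma supportedD J u w : supported J u -> supported J w -> supported J (u + w).
Proof. by move=> hu hw j jJ; rewrite mxE hu// hw// addr0. Qed.

Lemma supportedZ J (a : R) u : supported J u -> supported J (a *: u).
Proof. by move=> hu j jJ; rewrite mxE hu// mulr0. Qed.

Lemma supportedN J u : supported J u -> supported J (- u).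
Proof. by move=> hu j jJ; rewrite mxE hu// oppr0. Qed.

Lemma supportedB J u w : supported J u -> supported J w -> supported J (u - w).
Proof. by move=> hu hw; apply: supportedD => //; exact: supportedN. Qed.

Lemma sqn_ge0 u : 0 <= sqn u.
Proof. by apply: sumr_ge0 => j _; exact: sqr_ge0. Qed.

Lemma sqnZ (a : R) u : sqn (a *: u) = a ^+ 2 * sqn u.
Proof. by rewrite /sqn mulr_sumr; apply: eq_bigr => j _; rewrite mxE exprMn. Qed.

Lemma sqn_eq0 u : sqn u = 0 -> u = 0.
Proof.
move/eqP; rewrite /sqn psumr_eq0; last by move=> j _; exact: sqr_ge0.
move/allP => h; apply/rowP => j; rewrite mxE; apply/eqP.
by rewrite -sqrf_eq0; apply: h; rewrite mem_index_enum.
Qed.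

Lemma sqn_coord u j : u 0 j ^+ 2 <= sqn u.
Proof.
rewrite /sqn (bigD1 j)//= lerDl; apply: sumr_ge0 => k _; exact: sqr_ge0.
Qed.

Lemma supported_sum (T : nmodType) J u (F : 'I_p -> R -> T) :
  supported J u -> (forall j, F j 0 = 0) ->
  \sum_j F j (u 0 j) = \sum_(j in J) F j (u 0 j).
Proof.
move=> hu F0; rewrite (bigID (mem J))/= [X in _ + X]big1 ?addr0// => j jJ.
by rewrite hu.
Qed.

Lemma supported_l1 J u : supported J u ->
  (\sum_j `|u 0 j|) ^+ 2 <= #|J|%:R * sqn u.
Proof.
move=> hu.
rewrite /sqn (supported_sum (F := fun=> fun x => `|x|) hu (fun=> normr0 _)).
rewrite (supported_sum (F := fun=> fun x => x ^+ 2) hu); last by move=> j; rewrite expr0n.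
have := cauchy_schwarz_sum (mem J) (fun=> 1) (fun j => `|u 0 j|).
under eq_bigr do rewrite mul1r.
move/le_trans; apply; rewrite ler_pM//.
- by apply: sumr_ge0 => j _; rewrite expr1n.
- by apply: sumr_ge0 => j _; exact: sqr_ge0.
- under eq_bigr do rewrite expr1n.
  by rewrite sumr_const.
- by apply: ler_sum => j _; rewrite real_normK ?num_real.
Qed.

Lemma bilE H u w : bil H u w = \sum_j \sum_k u 0 j * H j k * w 0 k.
Proof.
rewrite /bil mxE exchange_big /=; apply: eq_bigr => k _.
by rewrite !mxE mulr_suml.
Qed.

Lemma bilDl H u u' w : bil H (u + u') w = bil H u w + bil H u' w.
Proof. by rewrite /bil !mulmxDl mxE. Qed.

Lemma bilDr H u w w' : bil H u (w + w') = bil H u w + bil H u w'.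
Proof. by rewrite /bil linearD /= mulmxDr mxE. Qed.

Lemma bilNl H u w : bil H (- u) w = - bil H u w.
Proof. by rewrite /bil !mulNmx mxE. Qed.

Lemma bilNr H u w : bil H u (- w) = - bil H u w.
Proof. by rewrite /bil linearN /= mulmxN mxE. Qed.

Lemma bilZl H (a : R) u w : bil H (a *: u) w = a * bil H u w.
Proof. by rewrite /bil -!scalemxAl mxE. Qed.

Lemma bilZr H (a : R) u w : bil H u (a *: w) = a * bil H u w.
Proof. by rewrite /bil linearZ /= -!scalemxAr mxE. Qed.

Lemma bil_sym H u w : H^T = H -> bil H u w = bil H w u.
Proof.
move=> hH; rewrite /bil; set M := w *m H *m u^T.
have -> : u *m H *m w^T = M^T by rewrite /M !trmx_mul trmxK hH mulmxA.
by rewrite mxE.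
Qed.

(* The principal submatrix H_JJ, completed by an identity block so that it can
   be inverted at size p. *)
Definition block_on J H : 'M[R]_p :=
  \matrix_(i, j) (if (i \in J) && (j \in J) then H i j else (i == j)%:R).

(** The vector of R^J that represents g for the form H. It is a Newton step when g is the score, and
    the H-orthogonal projection of u on R^J when g = u H. *)
Definition riesz J H g : 'rV[R]_p := vmask J g *m invmx (block_on J H).

Lemma block_on_outside J H u j : j \notin J -> (u *m block_on J H) 0 j = u 0 j.
Proof.
move=> jJ; rewrite mxE (bigD1 j)//= mxE (negbTE jJ) eqxx mulr1 big1 ?addr0// => k kj.
by rewrite mxE (negbTE jJ) andbF (negbTE kj) mulr0.
Qed.

Lemma block_on_inside J H u j : supported J u -> j \in J ->
  (u *m block_on J H) 0 j = (u *m H) 0 j.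
Proof.
move=> hu jJ; rewrite !mxE; apply: eq_bigr => k _; rewrite mxE jJ andbT.
by case: ifPn => // kJ; rewrite hu// !mul0r.
Qed.

Lemma bil_block_on J H u w : supported J u -> supported J w ->
  bil (block_on J H) u w = bil H u w.
Proof.
move=> hu hw; rewrite /bil mxE [RHS]mxE; apply: eq_bigr => j _.
have [jJ|jJ] := boolP (j \in J); last by rewrite [w^T _ _]mxE hw// !mulr0.
by rewrite block_on_inside.
Qed.

Lemma block_on_unit J H :
  (forall u, supported J u -> bil H u u = 0 -> u = 0) -> block_on J H \in unitmx.
Proof.
move=> hH; rewrite -row_free_unit; apply: inj_row_free => u hu.
(* Outside J the completed matrix is the identity, so a kernel vector vanishes there. *)
have su : supported J u.
  by move=> j jJ; rewrite -(block_on_outside H u jJ) hu mxE.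
apply: hH => //; rewrite -(bil_block_on H su su) /bil hu mul0mx mxE //.
Qed.

Lemma riesz_supported J H g : supported J (riesz J H g).
Proof.
move=> j jJ; rewrite /riesz; have [hH|hH] := boolP (block_on J H \in unitmx).
  by rewrite -(block_on_outside H _ jJ) mulmxKV// mxE (negbTE jJ).
(* [invmx] returns a singular matrix unchanged, so the support lies in J for every sample, even
   where the Hessian degenerates. *)
by rewrite invmx_out ?inE// block_on_outside// mxE (negbTE jJ).
Qed.

Lemma rieszP J H g u :
  (forall u, supported J u -> bil H u u = 0 -> u = 0) -> supported J u ->
  bil H (riesz J H g) u = \sum_j g 0 j * u 0 j.
Proof.
move=> hH su; rewrite -(bil_block_on H (@riesz_supported J H g) su) /bil /riesz.
rewrite mulmxKV ?block_on_unit// mxE; apply: eq_bigr => j _; rewrite !mxE.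
by case: ifPn => // jJ; rewrite su// !mulr0.
Qed.

End QuadraticForms.

(** * Linear predictors and Gram matrices of spins *)

Section Design.
Variables (R : realType) (p : nat) (I : finType).
Implicit Types (z : I -> config p) (w x : I -> R) (u : 'rV[R]_p).

Lemma dotE (c : config p) u : dot c u = ((\row_j spin R c j) *m u^T) 0 0.
Proof. by rewrite mxE; apply: eq_bigr => j _; rewrite !mxE. Qed.

Lemma dotD (c : config p) u u' : dot c (u + u') = dot c u + dot c u'.
Proof. by rewrite !dotE linearD /= mulmxDr mxE. Qed.

Lemma dotN (c : config p) u : dot c (- u) = - dot c u.
Proof. by rewrite !dotE linearN /= mulmxN mxE. Qed.

Lemma dotZ (c : config p) (a : R) u : dot c (a *: u) = a * dot c u.
Proof. by rewrite !dotE linearZ /= -scalemxAr mxE. Qed.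

Lemma dot0 (c : config p) : dot c (0 : 'rV[R]_p) = 0.
Proof. by rewrite dotE linear0 mulmx0 mxE. Qed.

Lemma spin_norm (c : config p) j : `|spin R c j| = 1.
Proof. by rewrite /spin; case: ifP; rewrite ?normrN normr1. Qed.

Lemma spin_sqr (c : config p) j : spin R c j ^+ 2 = 1.
Proof. by rewrite /spin; case: ifP; rewrite ?sqrrN expr1n. Qed.

Lemma dot_le_l1 (c : config p) u : `|dot c u| <= \sum_j `|u 0 j|.
Proof.
apply: le_trans (ler_norm_sum _ _ _) _; apply: ler_sum => j _.
by rewrite normrM spin_norm mul1r.
Qed.

Lemma dot_sqr_le (c : config p) u J k : supported J u -> (#|J| <= k)%N ->
  dot c u ^+ 2 <= k%:R * sqn u.
Proof.
move=> su Jk; apply: le_trans (_ : (\sum_j `|u 0 j|) ^+ 2 <= _).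
  rewrite -[leLHS]real_normK ?num_real// ler_sqr ?nnegrE ?dot_le_l1//.
  by apply: sumr_ge0 => j _.
apply: le_trans (supported_l1 su) _.
by rewrite ler_wpM2r ?sqn_ge0// ler_nat.
Qed.

(** The index type is kept general: 'I_n gives the empirical Hessian, and [config p] weighted by its
    masses gives the population one. *)
Definition gram w z : 'M[R]_p :=
  \matrix_(j, k) \sum_i w i * (spin R (z i) j * spin R (z i) k).

Lemma gramE w z u u' :
  bil (gram w z) u u' = \sum_i w i * dot (z i) u * dot (z i) u'.
Proof.
rewrite bilE.
under eq_bigr => j _ do under eq_bigr => k _ do rewrite mxE mulr_sumr mulr_suml.
under eq_bigr => j _ do rewrite exchange_big /=.
rewrite exchange_big /=; apply: eq_bigr => i _.
rewrite /dot -mulrA big_distrlr /= mulr_sumr; apply: eq_bigr => j _.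
rewrite mulr_sumr; apply: eq_bigr => k _; ring.
Qed.

Lemma gram_sym w z : (gram w z)^T = gram w z.
Proof.
by apply/matrixP => j k; rewrite !mxE; apply: eq_bigr => i _; rewrite [spin _ _ k * _]mulrC.
Qed.

End Design.

(** * Scalar inequalities of the deterministic part, isolated from their large terms *)

(** Young's inequality spends half of the quadratic term; the other half, a B / 4 >= 156 k,
    outweighs W / a <= 80 k and the remainder k / 8. *)
Lemma numeric_segment (R : realFieldType) (X b W B a eL k : R) :
  5 / 8 <= a -> 0 <= W -> 0 <= B -> X <= b + eL - a / 2 * B ->
  b <= W / (2 * (a / 2)) + a / 2 / 2 * B -> W <= 50 * k -> eL <= k * (1 / 8) ->
  10 * 100 * k <= B -> 0 <= k -> X <= 0.
Proof.
move=> ha W0 B0 hX hb hW heL hB k0.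
have hB' : 5 / 8 * B <= a * B by rewrite ler_wpM2r.
have hW' : W / (2 * (a / 2)) <= 8 / 5 * W.
  rewrite ler_pdivrMr; last by lra.
  have : 5 / 8 * W <= a * W by rewrite ler_wpM2r.
  lra.
lra.
Qed.

Lemma numeric_ratio (R : realFieldType) (Q c L eps : R) :
  1 <= Q -> 0 < c <= 1 -> 0 < L -> eps <= 1 / 8 -> eps * L <= Q * L / c * (1 / 8).
Proof.
move=> Q1 /andP[c0 c1] L0 he.
have h : 1 <= Q / c by rewrite ler_pdivlMr// mul1r (le_trans c1).
have h1 : eps * L <= 1 / 8 * L by rewrite ler_wpM2r// ltW.
have h2 : L * 1 <= L * (Q / c) by rewrite ler_wpM2l// ltW.
lra.
Qed.

Lemma numeric_radius (R : realFieldType) (Q c C L eps N B : R) :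
  1 <= Q -> 0 < c -> 0 < L -> 1 <= C ->
  100 * 100 * C * Q ^+ 2 * L <= eps ^+ 2 * c ^+ 2 * N ->
  c * N * (eps ^+ 2 / (2 * Q)) <= B -> 10 * 100 * (Q * L / c) <= B.
Proof.
move=> Q1 c0 L0 C1 k1 hB; apply: le_trans hB; rewrite mulrA ler_pdivrMr//.
have -> : c * N * (eps ^+ 2 / (2 * Q)) * c = eps ^+ 2 * c ^+ 2 * N / (2 * Q).
  by field; lra.
rewrite ler_pdivlMr; last by lra.
have k2 : Q ^+ 2 * L * 1 <= Q ^+ 2 * L * C.
  by rewrite ler_wpM2l// mulr_ge0// ?sqr_ge0// ltW.
have k3 : 0 <= Q ^+ 2 * L by rewrite mulr_ge0// ?sqr_ge0// ltW.
lra.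
Qed.

Lemma numeric_convex (R : realFieldType) (t a b m : R) :
  0 < t -> (1 - t) * a + t * b <= m -> m - a <= 0 -> b <= a.
Proof. by move=> t0 h1 h2; rewrite -(ler_pM2l t0); lra. Qed.

(** Completing the square: EV - a / 2 VV = ai / 2 W - a / 2 YY, where YY is the squared distance
    from V to the maximiser ai E. The loss 3 eps is one eps from ai >= 1 - eps and two from the grid
    cost. *)
Lemma numeric_grid (R : realFieldType) (W a ai C k y eps EV VV YY g c : R) :
  0 < eps <= 1 / 8 -> 0 <= W -> 1 <= C -> 0 <= k -> 1 <= a <= 2 -> a * ai = 1 -> 1 - eps <= ai ->
  YY = VV - 2 * ai * EV + ai ^+ 2 * W -> YY <= C * k -> c * g <= W ->
  EV - a / 2 * VV <= k * y + eps * c * g -> W / 2 * (1 - 3 * eps) <= k * (y + C).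
Proof.
move=> he W0 C1 k0 /andP[a1 a2] aai hai YE YC gW h.
have Ck : 0 <= C * k by rewrite mulr_ge0//; lra.
have EV' : EV - a / 2 * VV = ai / 2 * W - a / 2 * YY.
  have : a / 2 * YY = a / 2 * VV - (a * ai) * EV + (a * ai) * ai / 2 * W by rewrite YE; field.
  by rewrite aai; lra.
have h1 : a / 2 * YY <= C * k.
  apply: (@le_trans _ _ (a / 2 * (C * k))); first by rewrite ler_wpM2l//; lra.
  have : a * (C * k) <= 2 * (C * k) by rewrite ler_wpM2r.
  lra.
have h2 : eps * (c * g) <= eps * W by rewrite ler_wpM2l//; lra.
have h3 : (1 - eps) * W <= ai * W by rewrite ler_wpM2r.
by move: h; rewrite EV'; lra.
Qed.

Lemma numeric_missed (R : realFieldType) (sJ sS l cN SX JX QX : R) :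
  sJ <= l - cN / 2 -> l <= sS -> SX <= QX -> 0 <= JX -> QX < cN ->
  - 2 * sS + SX < - 2 * sJ + JX.
Proof. lra. Qed.

(** One factor 1 - 3 eps is lost in expanding the likelihood and one in passing to the grid, whence
    the square. *)
Lemma numeric_nested (R : realFieldType) (eps L k sJ sS l W y C X s : R) :
  0 < eps <= 1 / 8 -> 0 < L -> 1 <= k ->
  sJ <= l + W / (2 * (1 - 3 * eps)) + eps * L -> l <= sS ->
  W / 2 * (1 - 3 * eps) <= k * (y + C) ->
  (y + C) / (1 - 3 * eps) ^+ 2 + eps * L < X / 2 ->
  - 2 * sS + s * X < - 2 * sJ + (s + k) * X.
Proof.
move=> he L0 k1 h1 h2 h3 h4.
have a0 : 0 < 1 - 3 * eps by lra.
have h5 : W / (2 * (1 - 3 * eps)) <= k * ((y + C) / (1 - 3 * eps) ^+ 2).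
  rewrite mulrA ler_pdivlMr ?exprn_gt0//.
  have -> : W / (2 * (1 - 3 * eps)) * (1 - 3 * eps) ^+ 2 = W / 2 * (1 - 3 * eps).
    by field; lra.
  exact: h3.
have h6 : k * ((y + C) / (1 - 3 * eps) ^+ 2 + eps * L) < k * (X / 2) by rewrite ltr_pM2l//; lra.
have h7 : 1 * (eps * L) <= k * (eps * L) by rewrite ler_wpM2r// mulr_ge0//; lra.
lra.
Qed.

(** * The grid of rounded directions *)

Section Grid.
Variables (R : realType) (p n : nat).
Implicit Types (M : {ffun 'I_p -> option (bool * 'I_n.+1)}).

(** [None] marks a coordinate off the support, whereas [Some] of magnitude 0 stays in it, so
    rounding to 0 does not lose a prescribed support. That 0 has two signed codes only affects a
    constant. *)
Definition gval (g : option (bool * 'I_n.+1)) : R :=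
  if g is Some bk then (if bk.1 then bk.2%:R else - bk.2%:R) else 0.

Definition gdom M : {set 'I_p} := [set j | M j != None]%SET.

Definition gvec M : 'rV[R]_p := \row_j (gval (M j) / Num.sqrt n%:R).

Definition gcost M : R := \sum_j gval (M j) ^+ 2.

Lemma gvec_supported M : supported (gdom M) (gvec M).
Proof. by move=> j; rewrite inE negbK mxE => /eqP ->; rewrite mul0r. Qed.

Lemma gcostE M : (0 < n)%N -> gcost M = n%:R * sqn (gvec M).
Proof.
move=> n0; have N0 : 0 < n%:R :> R by rewrite ltr0n.
rewrite /gcost /sqn mulr_sumr; apply: eq_bigr => j _.
by rewrite mxE expr_div_n sqr_sqrtr ?ltW// mulrC divfK// gt_eqF.
Qed.

Lemma grid_round (x : R) : `|x| <= n%:R ->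
  exists g : bool * 'I_n.+1, `|gval (Some g)| <= `|x| /\ `|gval (Some g) - x| <= 1.
Proof.
move=> xn; have x0 := normr_ge0 x; have /andP[k1 k2] := truncn_itv x0.
set k := Num.truncn `|x| in k1 k2.
have kn : (k < n.+1)%N by rewrite ltnS -(ler_nat R); exact: le_trans xn.
exists (0 <= x, Ordinal kn); rewrite /gval /=.
have k0 : 0 <= k%:R :> R by [].
rewrite -natr1 in k2.
have [h|h] := lerP 0 x; [rewrite (ger0_norm h) in k1 k2 *|rewrite (ltr0_norm h) in k1 k2 *].
  by rewrite ger0_norm//; split => //; rewrite ler_norml; lra.
by rewrite normrN ger0_norm//; split => //; rewrite ler_norml; lra.
Qed.

(* Rounding towards zero keeps the grid point inside any ball containing e. *)
Lemma grid_near (e : 'rV[R]_p) (K : {set 'I_p}) : (0 < n)%N ->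
  (forall j, e 0 j ^+ 2 <= n%:R) ->
  exists M, [/\ gdom M = K, sqn (gvec M) <= sqn e &
    sqn (gvec M - vmask K e) <= #|K|%:R / n%:R].
Proof.
move=> n0 he; have N0 : 0 < n%:R :> R by rewrite ltr0n.
pose r : R := Num.sqrt n%:R; have r0 : 0 < r by rewrite sqrtr_gt0.
have rr : r ^+ 2 = n%:R by rewrite sqr_sqrtr// ltW.
have hb j : `|e 0 j * r| <= n%:R.
  rewrite -ler_sqr ?nnegrE ?(ltW N0)// real_normK ?num_real// exprMn rr.
  by rewrite [leRHS]expr2 ler_pM2r.
have [f hf] := choice (fun j => grid_round (hb j)).
exists [ffun j => if j \in K then Some (f j) else None]; split.
- by apply/setP => j; rewrite inE ffunE; case: ifP.
- apply: ler_sum => j _; rewrite mxE ffunE; case: ifP => jK; last first.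
    by rewrite mul0r expr0n sqr_ge0.
  have [h _] := hf j; rewrite expr_div_n rr ler_pdivrMr// -rr -exprMn.
  by rewrite -[leLHS]real_normK ?num_real// -[leRHS]real_normK ?num_real// ler_sqr ?nnegrE.
- rewrite /sqn (supported_sum (J := K) (F := fun=> fun x => x ^+ 2)).
  + apply: (@le_trans _ _ (\sum_(j in K) n%:R^-1)); last first.
      by rewrite sumr_const -[leLHS]mulr_natl.
    apply: ler_sum => j jK; rewrite !mxE ffunE jK.
    have [_ h] := hf j.
    have -> : gval (Some (f j)) / Num.sqrt n%:R - e 0 j = (gval (Some (f j)) - e 0 j * r) / r.
      by rewrite mulrBl mulfK// gt_eqF.
    rewrite expr_div_n rr ler_pdivrMr// mulVf ?gt_eqF//.
    by rewrite -[leLHS]real_normK ?num_real// expr_le1.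
  + by move=> j jK; rewrite !mxE ffunE (negbTE jK) mul0r subr0.
  + by move=> j; rewrite expr0n.
Qed.

End Grid.

Lemma supported_vmaskD (R : realType) (p : nat) (J S : {set 'I_p}) (e : 'rV[R]_p) :
  supported J e -> supported S (e - vmask (J :\: S) e).
Proof.
move=> se j jS; rewrite !mxE inE jS /=.
by case: ifPn => [_|jJ]; [rewrite subrr|rewrite subr0 se].
Qed.

Lemma subr_regroup (V : zmodType) (a b c d : V) : a - d = (a - c - b) + (c + (b - d)).
Proof. by rewrite [c + (b - d)]addrA -[a - c - b]addrA -opprD addrA subrK. Qed.

(** * Score, Hessian and log-likelihood of the node regression *)

Section Model.
Variables (R : realType) (p n : nat).
Implicit Types (z : 'I_n -> config p) (v : 'I_p) (u th : 'rV[R]_p) (J : {set 'I_p}).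

Definition pairing (g u : 'rV[R]_p) : R := \sum_j g 0 j * u 0 j.

Definition response z v (i : 'I_n) : R := (spin R (z i) v + 1) / 2.

Definition fitted z th (i : 'I_n) : R := sigm (dot (z i) th).

(** The gradient of [ll] at [th]; [hess] is minus its second derivative. *)
Definition score z v th : 'rV[R]_p :=
  \row_j \sum_(i < n) (response z v i - fitted z th i) * spin R (z i) j.

Definition hess z th : 'M[R]_p := gram (fun i => svar (dot (z i) th)) z.

Definition ll z v u : R :=
  \sum_(i < n) (response z v i * dot (z i) u - softplus (dot (z i) u)).

Lemma pairingZr g (a : R) u : pairing g (a *: u) = a * pairing g u.
Proof. by rewrite /pairing mulr_sumr; apply: eq_bigr => j _; rewrite mxE; ring. Qed.

Lemma pairing_bil (H : 'M[R]_p) u u' : pairing (u *m H) u' = bil H u u'.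
Proof. by rewrite /bil mxE /pairing; apply: eq_bigr => j _; rewrite [u'^T _ _]mxE. Qed.

Lemma score_pairing z v th u : pairing (score z v th) u =
  \sum_(i < n) (response z v i - fitted z th i) * dot (z i) u.
Proof.
rewrite /pairing; under eq_bigr do rewrite mxE mulr_suml.
rewrite exchange_big /=; apply: eq_bigr => i _; rewrite /dot mulr_sumr.
by apply: eq_bigr => j _; rewrite mulrA.
Qed.

Lemma pairing_sqr_le J (g u : 'rV[R]_p) (k : nat) (B : R) : supported J u ->
  (#|J| <= k)%N -> 0 <= B -> (forall j, j \in J -> g 0 j ^+ 2 <= B) ->
  pairing g u ^+ 2 <= k%:R * B * sqn u.
Proof.
move=> su Jk B0 gB; rewrite /pairing.
rewrite (supported_sum (F := fun j x => g 0 j * x) su); last by move=> j; rewrite mulr0.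
apply: le_trans (cauchy_schwarz_sum _ _ _) _.
rewrite /sqn [in leRHS](supported_sum (F := fun=> fun x => x ^+ 2) su); last first.
  by move=> j; rewrite expr0n.
rewrite ler_wpM2r//; first by apply: sumr_ge0 => j _; exact: sqr_ge0.
apply: le_trans (_ : \sum_(j in J) B <= _); first exact: ler_sum.
by rewrite sumr_const -[leLHS]mulr_natl ler_wpM2r// ler_nat.
Qed.

Lemma hessE z th u u' : bil (hess z th) u u' =
  \sum_(i < n) svar (dot (z i) th) * dot (z i) u * dot (z i) u'.
Proof. exact: gramE. Qed.

Lemma hess_ge0 z th u : 0 <= bil (hess z th) u u.
Proof.
rewrite hessE; apply: sumr_ge0 => i _; rewrite -mulrA -expr2.
by rewrite mulr_ge0 ?sqr_ge0// ltW// svar_gt0.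
Qed.

Lemma hess_sym z th u u' : bil (hess z th) u u' = bil (hess z th) u' u.
Proof. by apply: bil_sym; exact: gram_sym. Qed.

Lemma expR_sub1_le (t : R) : 0 <= t <= 1 / 2 -> expR t - 1 <= 2 * t.
Proof.
move=> /andP[t0 t1]; have := expR_ge1Dx (- t); have := expR_gt0 t => h1 h2.
have : expR t * expR (- t) = 1 by rewrite -expRD subrr expR0.
by nra.
Qed.

(* Self-concordance: relative to the Hessian at th, the error terms are
   governed by the size of the linear predictors only. *)
Lemma ll_expand z v th (D e : 'rV[R]_p) (eps : R) : 0 < eps <= 1 / 2 ->
  (forall i, `|dot (z i) D| <= eps) -> (forall i, `|dot (z i) e| <= eps) ->
  ll z v (th + D + e) - ll z v (th + D) <=
  pairing (score z v th) e - bil (hess z th) D e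
  + 2 * (\sum_(i < n) svar (dot (z i) th) * dot (z i) D ^+ 2 * `|dot (z i) e|)
  - (1 - 2 * eps) / 2 * bil (hess z th) e e.
Proof.
move=> /andP[eps0 eps1] hD he.
rewrite score_pairing !hessE /ll !mulr_sumr -!sumrB -big_split -sumrB /=.
apply: ler_sum => i _; rewrite !dotD /fitted.
set x := dot _ th; set y := response _ _ _.
have := hD i; have := he i; set a := dot _ D; set b := dot _ e => hb ha.
have v0 := svar_gt0 x.
have h1 := softplus_taylor_ge (x + a) b.
have h2 := svar_shift_ge x a.
have h3 := sigm_taylor x a.
have h4 : expR `|a| - 1 <= 2 * `|a| by apply: expR_sub1_le; rewrite normr_ge0 (le_trans ha).
(* Two shifts of size at most eps, by a and along b, give e^(-2 eps) >= 1 - 2 eps. *)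
have h5 : svar x * (1 - 2 * eps) <= svar (x + a) * expR (- `|b|).
  apply: le_trans (_ : svar x * expR (- `|a|) * expR (- `|b|) <= _); last first.
    by rewrite ler_pM2r ?expR_gt0.
  rewrite -mulrA ler_pM2l// -expRD; apply: le_trans (expR_ge1Dx _).
  lra.
have h6 : svar x * (1 - 2 * eps) * b ^+ 2 <= svar (x + a) * expR (- `|b|) * b ^+ 2.
  by rewrite ler_wpM2r ?sqr_ge0.
have h7 : svar x * (`|a| * (expR `|a| - 1)) <= svar x * (2 * a ^+ 2).
  rewrite ler_pM2l// -[a ^+ 2]real_normK ?num_real// expr2.
  have -> : 2 * (`|a| * `|a|) = `|a| * (2 * `|a|) by ring.
  by rewrite ler_wpM2l.
have h8 : - (b * (sigm (x + a) - sigm x - a * svar x)) <= `|b| * (svar x * (2 * a ^+ 2)).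
  rewrite (le_trans (ler_norm _))// normrN normrM ler_wpM2l//.
  exact: le_trans h3 h7.
have -> : y * (x + a + b) - softplus (x + a + b) - (y * (x + a) - softplus (x + a)) =
  y * b - (softplus (x + a + b) - softplus (x + a)) by ring.
lra.
Qed.

Lemma ll_concave z v u u' (t : R) : 0 <= t <= 1 ->
  (1 - t) * ll z v u + t * ll z v u' <= ll z v (u + t *: (u' - u)).
Proof.
move=> t01; rewrite /ll !mulr_sumr -big_split /=; apply: ler_sum => i _.
rewrite dotD dotZ dotD dotN.
have := softplus_convex (dot (z i) u) (dot (z i) u') t01; lra.
Qed.

(** Each term is the logarithm of a probability. This upper bound is what lets [sup] be compared
    with individual values. *)
Lemma ll_le0 z v u : ll z v u <= 0.
Proof.
rewrite /ll; apply: sumr_le0 => i _; rewrite subr_le0 /response /spin /softplus.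
set x := dot _ _; case: ifP => _.
  have -> : (1 + 1) / 2 * x = x by field.
  by rewrite -[leLHS]expRK ler_ln ?posrE ?expR_gt0 ?onepexp_gt0// lerDr.
by rewrite addNr mul0r mul0r ln_ge0// lerDl expR_ge0.
Qed.

Lemma loglikE z v J (b : 'I_p -> R) : loglik z J v b = ll z v (vmask J (\row_j b j)).
Proof.
rewrite /loglik /ll; apply: eq_bigr => i _ /=.
have -> : dot (z i) (vmask J (\row_j b j)) = \sum_(w in J) b w * spin R (z i) w.
  rewrite /dot [RHS]big_mkcond /=; apply: eq_bigr => j _; rewrite !mxE.
  by case: ifP; rewrite ?mulr0// mulrC.
by [].
Qed.

Lemma vmask_id J u : supported J u -> vmask J u = u.
Proof. by move=> su; apply/rowP => j; rewrite mxE; case: ifPn => // /su ->. Qed.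

Lemma ll_le_sup z v J u : supported J u -> ll z v u <= sup (range (loglik z J v)).
Proof.
move=> su; apply: ub_le_sup.
  by exists 0 => _ [b _ <-]; rewrite loglikE ll_le0.
exists (fun j => u 0 j) => //; rewrite loglikE; congr ll.
by rewrite -[RHS](vmask_id su); congr vmask; apply/rowP => j; rewrite mxE.
Qed.

Lemma sup_loglik_le z v J (B : R) : (forall u, supported J u -> ll z v u <= B) ->
  sup (range (loglik z J v)) <= B.
Proof.
move=> h; apply: ge_sup; first by exists (loglik z J v (fun=> 0)); exists (fun=> 0).
by move=> _ [b _ <-]; rewrite loglikE; apply: h; exact: vmask_supported.
Qed.

End Model.

(** * Selection at one node on the good event, for a fixed sample *)

Section Deterministic.
Variables (R : realType) (p n q : nat) (z : 'I_n -> config p) (v : 'I_p).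
Variables (th : 'rV[R]_p) (S : {set 'I_p}) (L c C eps : R).
Implicit Types (J : {set 'I_p}) (u e : 'rV[R]_p).
Let N : R := n%:R.
Let Q : R := q%:R.
Let H := hess z th.
Let sc := score z v th.
Hypothesis n0 : (0 < n)%N.
Hypothesis q0 : (0 < q)%N.
Hypothesis L0 : 0 < L.
Hypothesis c01 : 0 < c <= 1.
Hypothesis C1 : 1 <= C.
Hypothesis eps01 : 0 < eps <= 1 / 8.
Hypothesis sth : supported S th.
Hypothesis vS : v \notin S.
Hypothesis Sq : (#|S| <= q)%N.
(* The quantitative form of q^3 L / n -> 0 that absorbs every remainder term. *)
Hypothesis key : 100 * 100 * C * Q ^+ 3 * L <= eps ^+ 2 * c ^+ 3 * N.
Hypothesis curv : forall J u, v \notin J -> (#|J| <= 2 * q)%N -> supported J u ->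
  c * N * sqn u <= bil H u u <= C * N * sqn u.
Hypothesis score_le : forall j, j != v -> sc 0 j ^+ 2 <= 25 * N * L.

Lemma sample_size_gt0 : 0 < N. Proof. by rewrite ltr0n. Qed.
Lemma sparsity_ge1 : 1 <= Q. Proof. by rewrite ler1n. Qed.
Let c0 : 0 < c. Proof. by case/andP: c01. Qed.
Let e0 : 0 < eps. Proof. by case/andP: eps01. Qed.
Let eps2 : 0 < eps <= 1 / 2. Proof. by move: eps01; lra. Qed.

Lemma pairing_score_le J u : v \notin J -> (#|J| <= 2 * q)%N -> supported J u ->
  pairing sc u ^+ 2 <= 50 * Q * N * L * sqn u.
Proof.
move=> vJ Jq su.
have /(_ (25 * N * L)) := pairing_sqr_le (g := sc) su Jq.
have B0 : 0 <= 25 * N * L by rewrite !mulr_ge0// ltW// sample_size_gt0.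
move=> /(_ B0); rewrite natrM => h.
apply: le_trans (h _) _; last by rewrite le_eqVlt; apply/orP; left; apply/eqP; rewrite /Q; ring.
by move=> j jJ; apply: score_le; apply: contraNneq vJ => <-.
Qed.

Lemma curv_definite J : v \notin J -> (#|J| <= 2 * q)%N ->
  forall u, supported J u -> bil H u u = 0 -> u = 0.
Proof.
move=> vJ Jq u su hu; apply: sqn_eq0; apply/eqP; rewrite eq_le sqn_ge0 andbT.
have /andP[h _] := curv vJ Jq su; move: h; rewrite hu => h.
by rewrite -(pmulr_rle0 (sqn u) (mulr_gt0 c0 sample_size_gt0)).
Qed.

(** B^2 = pairing^2 <= 50 Q N L |u|^2, while |u|^2 <= B / (c N); one factor B cancels. *)
Lemma newton_le J u : v \notin J -> (#|J| <= 2 * q)%N -> supported J u ->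
  bil H u u = pairing sc u -> bil H u u <= 50 * Q * L / c.
Proof.
move=> vJ Jq su hu; have /andP[h1 _] := curv vJ Jq su.
have h2 := pairing_score_le vJ Jq su; rewrite -hu in h2.
have B0 := hess_ge0 z th u; rewrite -/H in B0.
set B := bil H u u in B0 h1 h2 *.
have N0 := sample_size_gt0; have Q1 := sparsity_ge1.
rewrite ler_pdivlMr//.
have h3 : B * (B * c) <= B * (50 * Q * L).
  have : 50 * Q * L * (c * N * sqn u) <= 50 * Q * L * B.
    by rewrite ler_wpM2l// !mulr_ge0// ltW.
  have : B ^+ 2 * c <= 50 * Q * N * L * sqn u * c by rewrite ler_wpM2r// ltW.
  by lra.
have [->|Bn0] := eqVneq B 0; first by rewrite mul0r !mulr_ge0// ltW.
by rewrite -(ler_pM2l (_ : 0 < B))// lt_neqAle eq_sym Bn0.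
Qed.

Lemma dot_le_sqrt (e : R) J u i : 0 <= e -> (#|J| <= 2 * q)%N -> supported J u ->
  2 * Q * sqn u <= e ^+ 2 -> `|dot (z i) u| <= e.
Proof.
move=> e_ge0 Jq su h; rewrite -ler_sqr ?nnegrE// real_normK ?num_real//.
apply: le_trans (dot_sqr_le (z i) su Jq) _; by rewrite natrM.
Qed.

Lemma key_sqr : 100 * 100 * C * Q ^+ 2 * L <= eps ^+ 2 * c ^+ 3 * N.
Proof.
apply: le_trans key; have Q1 := sparsity_ge1.
by rewrite ler_pM2r// ler_pM2l ?ler_weXn2l//; move: C1; lra.
Qed.

(** The difference u - th lives on the union of J and S, of size at most 2 q. At squared distance r2
    from th the Hessian term costs 3/8 c N r2 and the score returns at most 1/4 c N r2; concavity
    carries the net loss on to u. *)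
Lemma missed_signal J u (w : 'I_p) (r2 : R) : v \notin J -> (#|J| <= q)%N ->
  supported J u -> w \in S -> w \notin J -> 0 < r2 -> r2 <= th 0 w ^+ 2 ->
  2 * Q * r2 <= eps ^+ 2 -> 8 * 100 * Q * L <= c ^+ 2 * N * r2 ->
  ll z v u <= ll z v th - c / 8 * N * r2.
Proof.
move=> vJ Jq su wS wJ r0 rth re hr.
have N0 := sample_size_gt0; have Q1 := sparsity_ge1.
pose d := u - th.
have sd : supported (J :|: S) d.
  apply: supportedB; first exact: supportedS (finset.subsetUl _ _) su.
  exact: supportedS (finset.subsetUr _ _) sth.
have dq : (#|J :|: S| <= 2 * q)%N.
  by apply: (leq_trans (leq_card_setU _ _)); rewrite mul2n -addnn leq_add.
have vJS : v \notin J :|: S by rewrite inE negb_or vJ.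
have sd0 : r2 <= sqn d.
  apply: le_trans rth _; apply: le_trans (sqn_coord d w).
  by rewrite !mxE su// sub0r sqrrN.
have sdp : 0 < sqn d := lt_le_trans r0 sd0.
(* Shrinks u - th to squared length r2, where all predictors are at most eps. *)
pose t := Num.sqrt (r2 / sqn d).
have tt : t ^+ 2 = r2 / sqn d by rewrite sqr_sqrtr// divr_ge0// ltW.
have t0 : 0 < t by rewrite sqrtr_gt0 divr_gt0.
have t1 : t <= 1.
  by rewrite -(@ler_sqr _ t 1) ?nnegrE ?(ltW t0)// expr1n tt ler_pdivrMr// mul1r.
have st : sqn (t *: d) = r2 by rewrite sqnZ tt divfK// gt_eqF.
have std := supportedZ t sd.
have hdot i : `|dot (z i) (t *: d)| <= eps.
  by apply: (dot_le_sqrt _ _ dq std); rewrite ?st// ltW.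
have hz (i : 'I_n) : `|dot (z i) (0 : 'rV[R]_p)| <= eps by rewrite dot0 normr0 ltW.
have := ll_expand v th eps2 hz hdot; rewrite addr0.
rewrite [\sum_(i < n) _]big1; last by move=> i _; rewrite dot0 expr0n mulr0 mul0r.
have -> : bil (hess z th) 0 (t *: d) = 0 by rewrite -(scale0r 0) bilZl mul0r.
rewrite -/sc -/H => h1.
have /andP[h2 _] := curv vJS dq std; rewrite st in h2.
have h3 := pairing_score_le vJS dq std; rewrite st in h3.
have h4 : pairing sc (t *: d) <= c / 4 * N * r2.
  apply: le_trans (ler_norm _) _.
  have P0 : 0 <= c / 4 * N * r2 by rewrite !mulr_ge0// ltW// ?invr_gt0.
  rewrite -ler_sqr ?nnegrE// real_normK ?num_real//; apply: le_trans h3 _.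
  have : N * r2 * (8 * 100 * Q * L) <= N * r2 * (c ^+ 2 * N * r2).
    by rewrite ler_wpM2l// mulr_ge0// ltW.
  by move=> h; apply: (@le_trans _ _ (N * r2 * (c ^+ 2 * N * r2) / 16)); lra.
have h5 : 3 / 8 * (c * N * r2) <= (1 - 2 * eps) / 2 * bil H (t *: d) (t *: d).
  rewrite ler_pM//; last by move: eps01; lra.
  by rewrite !mulr_ge0// ltW.
have t01 : 0 <= t <= 1 by rewrite t1 ltW.
have h6 := ll_concave z v th u t01; rewrite -/d in h6.
have D0 : 0 <= c * N * r2 by rewrite !mulr_ge0// ltW.
have : t * (ll z v u - ll z v th) <= t * (- (c / 8 * N * r2)).
  apply: (@le_trans _ _ (- (c / 8 * N * r2))); first by lra.
  have : 0 <= (1 - t) * (c * N * r2) by rewrite mulr_ge0// subr_ge0.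
  lra.
rewrite ler_pM2l//; lra.
Qed.



Let D := riesz S H sc.

Lemma true_support_le : (#|S| <= 2 * q)%N.
Proof. by rewrite (leq_trans Sq)// leq_pmull. Qed.

Lemma newton_supported : supported S D.
Proof. exact: riesz_supported. Qed.

Lemma newtonP u : supported S u -> bil H D u = pairing sc u.
Proof. by move=> su; apply: (rieszP _ _ su); exact/curv_definite/true_support_le. Qed.

Lemma newton_quad_le : bil H D D <= 50 * Q * L / c.
Proof. exact: newton_le vS true_support_le newton_supported (newtonP newton_supported). Qed.

Lemma small_quad J u (B : R) : v \notin J -> (#|J| <= 2 * q)%N -> supported J u ->
  bil H u u <= B -> 2 * Q * B <= eps ^+ 2 * (c * N) -> forall i, `|dot (z i) u| <= eps.
Proof.
move=> vJ Jq su hB h i; apply: (dot_le_sqrt _ _ Jq su); first exact: ltW.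
have N0 := sample_size_gt0; have Q1 := sparsity_ge1; have cN : 0 < c * N by rewrite mulr_gt0.
have /andP[h1 _] := curv vJ Jq su.
rewrite -(ler_pM2r cN); apply: le_trans h.
have : 2 * Q * (c * N * sqn u) <= 2 * Q * B.
  by rewrite ler_wpM2l ?(le_trans h1)// mulr_ge0//; lra.
by lra.
Qed.

Lemma curv_cube_le : c ^+ 3 <= c ^+ 2.
Proof. by rewrite exprS ger_pMl ?exprn_gt0//; case/andP: c01. Qed.

Lemma key_sqr_curv : 100 * 100 * C * Q ^+ 2 * L <= eps ^+ 2 * c ^+ 2 * N.
Proof.
apply: le_trans key_sqr _; rewrite ler_pM2r ?sample_size_gt0// ler_pM2l ?exprn_gt0//.
exact: curv_cube_le.
Qed.

Lemma newton_small : 2 * Q * (50 * Q * L / c) <= eps ^+ 2 * (c * N).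
Proof.
rewrite mulrA ler_pdivrMr//; have := key_sqr_curv.
have : Q ^+ 2 * L * 1 <= Q ^+ 2 * L * C by rewrite ler_wpM2l// mulr_ge0// ?sqr_ge0// ltW.
have : 0 <= Q ^+ 2 * L by rewrite mulr_ge0// ?sqr_ge0// ltW.
lra.
Qed.

Lemma newton_dot_le i : `|dot (z i) D| <= eps.
Proof. exact: small_quad vS true_support_le newton_supported newton_quad_le newton_small i. Qed.

Section Nested.
Variable J : {set 'I_p}.
Hypothesis vJ : v \notin J.
Hypothesis Jq : (#|J| <= q)%N.
Hypothesis SJ : S \subset J.

Let DJ := riesz J H sc.
Let E := DJ - D.
Let W := bil H E E.

Lemma candidate_le : (#|J| <= 2 * q)%N.
Proof. by rewrite (leq_trans Jq)// leq_pmull. Qed.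

Lemma newton_candidate_supported : supported J DJ.
Proof. exact: riesz_supported. Qed.

Lemma newton_candidateP u : supported J u -> bil H DJ u = pairing sc u.
Proof. by move=> su; apply: (rieszP _ _ su); exact/curv_definite/candidate_le. Qed.

Lemma newton_diff_supported : supported J E.
Proof. by apply: supportedB; [exact: newton_candidate_supported|exact: supportedS SJ newton_supported]. Qed.

(** Both Newton steps represent the score on R^S. *)
Lemma newton_diff_orth u : supported S u -> bil H E u = 0.
Proof.
move=> su; rewrite /E bilDl bilNl newtonP// newton_candidateP ?subrr//; exact: supportedS SJ su.
Qed.

Lemma gain_ge0 : 0 <= W. Proof. exact: hess_ge0. Qed.

(** Pythagoras for H: the square of DJ is that of E plus that of D. *)
Lemma gain_le : W <= 50 * Q * L / c.
Proof.
apply: le_trans (newton_le vJ candidate_le newton_candidate_supported (newton_candidateP newton_candidate_supported)).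
have -> : DJ = E + D by rewrite /E subrK.
rewrite bilDl (bilDr _ E E D) (bilDr _ D E D) [bil H D E]hess_sym (newton_diff_orth newton_supported) addr0 add0r.
by rewrite lerDl hess_ge0.
Qed.

(** Guarantees that the coordinates of E, multiplied by sqrt n, stay within the range of the
    grid. *)
Lemma newton_bound_le : 50 * Q * L / c <= n%:R * (c * N).
Proof.
have N0 := sample_size_gt0; have Q1 := sparsity_ge1; have cN : 0 < c * N by rewrite mulr_gt0.
apply: (@le_trans _ _ (2 * Q * (50 * Q * L / c))).
  apply: ler_peMl; last by lra.
  by rewrite !mulr_ge0 ?invr_ge0 ?(ltW c0) ?(ltW L0).
apply: le_trans newton_small _; rewrite ler_pM2r//; apply: (@le_trans _ _ 1).
  by rewrite expr_le1 ?(ltW e0)//; case/andP: eps2; lra.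
by rewrite ler1n.
Qed.

Lemma hess_young (x y : 'rV[R]_p) (a : R) : 0 < a ->
  bil H x y <= bil H x x / (2 * a) + a / 2 * bil H y y.
Proof.
move=> a0; have := hess_ge0 z th (x - a *: y); rewrite -/H.
rewrite !(bilDl, bilDr, bilNl, bilNr, bilZl, bilZr) [bil H y x]hess_sym => h.
rewrite -(@ler_pM2l _ (2 * a)) ?mulr_gt0//.
have -> : 2 * a * (bil H x x / (2 * a) + a / 2 * bil H y y) =
  bil H x x + a ^+ 2 * bil H y y by field; rewrite gt_eqF.
by lra.
Qed.

(** The predictor of e is at most sqrt (2 Q |e|_H^2 / (c N)) and |D|_H^2 <= 50 Q L / c. Young's
    inequality leaves 100^2 Q^3 L^2 / (eps c^3 N), which is where q^3 and the constant of [key] come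
    from. *)
Lemma remainder_le e : supported J e ->
  2 * (\sum_(i < n) svar (dot (z i) th) * dot (z i) D ^+ 2 * `|dot (z i) e|)
  <= eps / 2 * bil H e e + eps * L.
Proof.
move=> se; have N0 := sample_size_gt0; have Q1 := sparsity_ge1; have cN : 0 < c * N by rewrite mulr_gt0.
set A := bil H D D; set B := bil H e e.
have A0 : 0 <= A by exact: hess_ge0.
have B0 : 0 <= B by exact: hess_ge0.
pose m := Num.sqrt (2 * Q * B / (c * N)).
have m0 : 0 <= m by exact: sqrtr_ge0.
have m2 : m ^+ 2 = 2 * Q * B / (c * N).
  by rewrite sqr_sqrtr// divr_ge0 ?(ltW cN)// !mulr_ge0//; lra.
have hm i : `|dot (z i) e| <= m.
  apply: (dot_le_sqrt _ _ candidate_le se) => //; rewrite m2 ler_pdivlMr//.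
  have /andP[h1 _] := curv vJ candidate_le se.
  have : 2 * Q * (c * N * sqn e) <= 2 * Q * B.
    by rewrite ler_wpM2l// mulr_ge0//; lra.
  by lra.
have h : \sum_(i < n) svar (dot (z i) th) * dot (z i) D ^+ 2 * `|dot (z i) e| <= A * m.
  rewrite /A hessE mulr_suml; apply: ler_sum => i _.
  rewrite -[_ * dot (z i) D * dot _ _]mulrA -expr2 ler_wpM2l//.
  by rewrite mulr_ge0 ?sqr_ge0// ltW// svar_gt0.
apply: (@le_trans _ _ (2 * (A * m))); first by rewrite ler_pM2l.
(* The weight is chosen so that the m^2 term equals eps / 2 * B. *)
have am : 2 * (A * m) <= eps * c * N / (4 * Q) * m ^+ 2 + 4 * Q / (eps * c * N) * A ^+ 2.
  have P0 : 0 < eps * c * N by rewrite !mulr_gt0.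
  have Q40 : 0 < 4 * Q by lra.
  have hh := sqr_ge0 (eps * c * N * m - 4 * Q * A).
  rewrite -subr_ge0.
  have -> : eps * c * N / (4 * Q) * m ^+ 2 + 4 * Q / (eps * c * N) * A ^+ 2 - 2 * (A * m)
    = (eps * c * N * m - 4 * Q * A) ^+ 2 / ((4 * Q) * (eps * c * N)).
    by field; rewrite !gt_eqF//; lra.
  by rewrite divr_ge0// mulr_ge0// ltW.
apply: le_trans am _; apply: lerD.
  rewrite m2 le_eqVlt; apply/orP; left; apply/eqP; field; rewrite !gt_eqF//; lra.
have A2 : A ^+ 2 <= (50 * Q * L / c) ^+ 2.
  by rewrite ler_sqr ?nnegrE ?newton_quad_le// (le_trans A0 newton_quad_le).
apply: (@le_trans _ _ (4 * Q / (eps * c * N) * (50 * Q * L / c) ^+ 2)).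
  rewrite ler_wpM2l// divr_ge0//; first by lra.
  by rewrite !mulr_ge0// ltW.
have -> : 4 * Q / (eps * c * N) * (50 * Q * L / c) ^+ 2 =
   L * (100 * 100 * Q ^+ 3 * L) / (eps * c ^+ 3 * N).
  by field; rewrite !gt_eqF//; lra.
rewrite ler_pdivrMr ?mulr_gt0 ?exprn_gt0//.
have -> : eps * L * (eps * c ^+ 3 * N) = L * (eps ^+ 2 * c ^+ 3 * N) by ring.
rewrite ler_pM2l//; apply: le_trans key.
have : Q ^+ 3 * L * 1 <= Q ^+ 3 * L * C.
  by rewrite ler_wpM2l// mulr_ge0 ?exprn_ge0 ?ltW//; lra.
by lra.
Qed.

Lemma local_expand e : supported J e -> (forall i, `|dot (z i) e| <= eps) ->
  ll z v (th + D + e) - ll z v (th + D) <=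
  bil H E e + eps * L - (1 - 3 * eps) / 2 * bil H e e.
Proof.
move=> se he; have := ll_expand v th eps2 newton_dot_le he; rewrite -/sc -/H.
have := remainder_le se; rewrite -(newton_candidateP se) /E bilDl bilNl.
by lra.
Qed.

(** If u is near th + D, the local expansion and Young's inequality suffice. Otherwise the segment
    to u is cut at squared length eps^2 / (2 Q), where [ll] is already at most its value at th + D,
    and by concavity it cannot exceed that value at u. *)
Lemma ll_nested_le u : supported J u ->
  ll z v u <= ll z v (th + D) + W / (2 * (1 - 3 * eps)) + eps * L.
Proof.
move=> su; have N0 := sample_size_gt0; have Q1 := sparsity_ge1; have W0 := gain_ge0.
have a0 : 5 / 8 <= 1 - 3 * eps by move: eps01; lra.
have a1 : 0 < 1 - 3 * eps by lra.
have W' : 0 <= W / (2 * (1 - 3 * eps)) by rewrite divr_ge0//; lra.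
have L' : 0 <= eps * L by rewrite mulr_ge0// ltW.
pose e := u - (th + D).
have ue : th + D + e = u by rewrite /e subrKC.
have se : supported J e.
  apply: supportedB => //; apply: (supportedS SJ); apply: supportedD => //; exact: newton_supported.
have [small|big] := lerP (2 * Q * sqn e) (eps ^+ 2).
  have he i : `|dot (z i) e| <= eps by apply: (dot_le_sqrt _ _ candidate_le se) => //; exact: ltW.
  have := local_expand se he; have := hess_young E e a1; rewrite ue -/W; lra.
have se0 : 0 < sqn e.
  rewrite -(pmulr_rgt0 _ (_ : 0 < 2 * Q)); last by lra.
  by apply: le_lt_trans big; exact: sqr_ge0.
pose t := Num.sqrt (eps ^+ 2 / (2 * Q * sqn e)).
have q20 : 0 < 2 * Q * sqn e by apply: mulr_gt0 => //; lra.
have tt : t ^+ 2 = eps ^+ 2 / (2 * Q * sqn e).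
  by rewrite sqr_sqrtr// divr_ge0// ?sqr_ge0// ltW.
have t0 : 0 < t by rewrite sqrtr_gt0 divr_gt0// exprn_gt0.
have t1 : t <= 1.
  by rewrite -(@ler_sqr _ t 1) ?nnegrE ?(ltW t0)// expr1n tt ler_pdivrMr// mul1r ltW.
have st : sqn (t *: e) = eps ^+ 2 / (2 * Q).
  by rewrite sqnZ tt; field; rewrite !gt_eqF//; lra.
have ste := supportedZ t se.
have hdot i : `|dot (z i) (t *: e)| <= eps.
  apply: (dot_le_sqrt _ _ candidate_le ste); first exact: ltW.
  by rewrite st mulrC divfK// gt_eqF//; lra.
have h1 := local_expand ste hdot.
have a2 : 0 < (1 - 3 * eps) / 2 by rewrite divr_gt0.
have h2 := hess_young E (t *: e) a2; rewrite -/W in h2.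
have /andP[h3 _] := curv vJ candidate_le ste; rewrite st in h3.
have W3 : W <= 50 * (Q * L / c) by have := gain_le; rewrite !mulrA.
have L2 : eps * L <= Q * L / c * (1 / 8) by apply: numeric_ratio => //; case/andP: eps01.
have QLc : 0 <= Q * L / c by rewrite !mulr_ge0 ?invr_ge0 ?(ltW c0) ?(ltW L0).
have hneg : ll z v (th + D + t *: e) - ll z v (th + D) <= 0.
  apply: numeric_segment a0 W0 (hess_ge0 _ _ _) h1 h2 W3 L2 _ QLc.
  exact: numeric_radius key_sqr_curv h3.
have t01 : 0 <= t <= 1 by rewrite t1 ltW.
have := ll_concave z v (th + D) u t01; rewrite -/e => h6.
have h8 := numeric_convex t0 h6 hneg.
by apply: le_trans h8 _; rewrite -addrA lerDl addr_ge0.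
Qed.

(** The functional V -> bil H E V - e^eps / 2 |V|_H^2 is largest at e^(-eps) E. A bound on it at a
    nearby grid direction therefore bounds W. *)
Lemma score_grid_le (y : R) :
  (forall M : {ffun 'I_p -> option (bool * 'I_n.+1)}, gdom M = J :\: S ->
    let V := gvec R M - riesz S H (gvec R M *m H) in
    (forall i, `|dot (z i) V| <= eps) ->
    pairing sc V - expR eps / 2 * bil H V V <= #|gdom M|%:R * y + eps * c * gcost R M) ->
  W / 2 * (1 - 3 * eps) <= #|J :\: S|%:R * (y + C).
Proof.
move=> hM; set K := J :\: S.
have N0 := sample_size_gt0; have cN : 0 < c * N by rewrite mulr_gt0.
have a0 := expR_gt0 eps; have a1 : 1 <= expR eps by rewrite -expR0 ler_expR ltW.
have aV : expR eps * expR (- eps) = 1 by rewrite -expRD subrr expR0.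
have a2 : expR eps <= 2.
  have he2 : 0 <= eps <= 1 / 2 by case/andP: eps2 => h1 h2; rewrite h2 ltW.
  by have := expR_sub1_le he2; rewrite lerBlDr => /le_trans; apply; case/andP: eps2; lra.
have ai1 : 1 - eps <= expR (- eps) by have := expR_ge1Dx (- eps).
set a := expR eps in a0 a1 a2 aV hM; set ai := expR (- eps) in aV ai1.
have ai0 : 0 < ai by exact: expR_gt0.
have aile : ai <= 1 by rewrite -aV ler_peMl// ltW.
have sEW : sqn E <= W / (c * N).
  by rewrite ler_pdivlMr// mulrC; have /andP[] := curv vJ candidate_le newton_diff_supported.
have sqnE : sqn (ai *: E) <= sqn E.
  by rewrite sqnZ ler_piMl ?sqn_ge0// expr_le1// ltW.
have hE j : (ai *: E) 0 j ^+ 2 <= n%:R.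
  apply: le_trans (sqn_coord _ _) _; apply: le_trans sqnE _; apply: le_trans sEW _.
  rewrite ler_pdivrMr//; exact: le_trans gain_le newton_bound_le.
(* Only the J \ S block is rounded: E is H-orthogonal to R^S, so subtracting the projection on R^S
   recovers the S block. *)
have [M [dM sgE sgr]] := grid_near K n0 hE.
have sg : supported K (gvec R M) by rewrite -dM; exact: gvec_supported.
have KJ : K \subset J by exact: subsetDl.
pose P := riesz S H (gvec R M *m H).
have defS := curv_definite vS true_support_le.
have sP : supported S P by exact: riesz_supported.
pose V := gvec R M - P.
have sV : supported J V.
  by apply: supportedB; [exact: supportedS KJ sg|exact: supportedS SJ sP].
have oV u : supported S u -> bil H V u = 0.
  by move=> su; rewrite /V bilDl bilNl rieszP// -/(pairing _ _) pairing_bil subrr.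
pose r := gvec R M - vmask K (ai *: E).
have sr : supported J r.
  apply: (supportedS KJ); apply: supportedB => //; exact: vmask_supported.
pose m := P + (ai *: E - vmask K (ai *: E)).
have sm : supported S m.
  apply: supportedD => //; apply: supported_vmaskD; exact/supportedZ/newton_diff_supported.
pose Y := V - ai *: E.
(* m lies in R^S and Y is H-orthogonal to it, so Y is no longer than the rounding error r. *)
have rE : r = Y + m.
  exact: subr_regroup.
have oY : bil H Y m = 0 by rewrite bilDl bilNl bilZl oV// newton_diff_orth// mulr0 subrr.
have YC : bil H Y Y <= C * #|K|%:R.
  apply: (@le_trans _ _ (bil H r r)).
    rewrite rE bilDl (bilDr _ Y) (bilDr _ m) [bil H m Y]hess_sym oY addr0 add0r.
    by rewrite lerDl; exact: hess_ge0.
  have /andP[_ h] := curv vJ candidate_le sr; apply: le_trans h _.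
  rewrite -mulrA ler_pM2l ?(lt_le_trans ltr01 C1)// mulrC -ler_pdivlMr//.
have VP : bil H V V <= 50 * C * Q * L / c ^+ 2.
  apply: (@le_trans _ _ (bil H (gvec R M) (gvec R M))).
    have -> : gvec R M = V + P by rewrite subrK.
    rewrite bilDl (bilDr _ V) (bilDr _ P) [bil H P V]hess_sym (oV _ sP) addr0 add0r.
    by rewrite lerDl; exact: hess_ge0.
  have /andP[_ h] := curv vJ candidate_le (supportedS KJ sg); apply: le_trans h _.
  have CN : 0 < C * N by rewrite mulr_gt0// (lt_le_trans ltr01 C1).
  apply: (@le_trans _ _ (C * N * (W / (c * N)))).
    rewrite ler_pM2l//; apply: le_trans sgE _; exact: le_trans sqnE sEW.
  have -> : C * N * (W / (c * N)) = C / c * W by field; rewrite !gt_eqF.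
  have -> : 50 * C * Q * L / c ^+ 2 = C / c * (50 * Q * L / c) by field; rewrite !gt_eqF.
  by rewrite ler_wpM2l ?gain_le// divr_ge0 ?(ltW c0)// (le_trans ler01 C1).
have Vs i : `|dot (z i) V| <= eps.
  apply: small_quad vJ candidate_le sV VP _ i.
  rewrite mulrA ler_pdivrMr ?exprn_gt0//.
  have -> : eps ^+ 2 * (c * N) * c ^+ 2 = eps ^+ 2 * c ^+ 3 * N by ring.
  apply: le_trans key_sqr.
  have -> : 2 * Q * (50 * C * Q * L) = 100 * (C * Q ^+ 2 * L) by ring.
  have -> : 100 * 100 * C * Q ^+ 2 * L = 100 * (100 * (C * Q ^+ 2 * L)) by ring.
  rewrite ler_pM2l//; apply: ler_peMl; last by rewrite ler1n.
  by rewrite !mulr_ge0 ?sqr_ge0 ?(ltW L0)// (le_trans ler01 C1).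
have := hM M dM Vs; rewrite dM -/K -(newton_candidateP sV).
have -> : bil H DJ V = bil H E V.
  by rewrite /E bilDl bilNl [bil H D V]hess_sym (oV _ newton_supported) oppr0 addr0.
apply: numeric_grid eps01 gain_ge0 C1 (ler0n _ _) _ aV ai1 _ YC _ => //.
- by rewrite a1.
- rewrite /Y bilDl bilNl bilZl (bilDr _ V) (bilDr _ E) !bilNr !bilZr [bil H V E]hess_sym.
  by rewrite -/W; ring.
- rewrite gcostE// mulrA -ler_pdivlMl//; apply: le_trans sgE _; apply: le_trans sqnE _.
  by rewrite mulrC.
Qed.

End Nested.

(** [y] is the level allowed per coordinate of J \ S. The strict inequality keeps it, inflated by
    all losses, below half the penalty of one coordinate. *)
Lemma selection_deterministic (y gamma r2 : R) :
  let X := ln N + 2 * gamma * ln p%:R in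
  (forall M : {ffun 'I_p -> option (bool * 'I_n.+1)}, v \notin gdom M -> (0 < #|gdom M|)%N ->
    let V := gvec R M - riesz S H (gvec R M *m H) in
    (forall i, `|dot (z i) V| <= eps) ->
    pairing sc V - expR eps / 2 * bil H V V <= #|gdom M|%:R * y + eps * c * gcost R M) ->
  0 <= X -> (y + C) / (1 - 3 * eps) ^+ 2 + eps * L < X / 2 ->
  0 < r2 -> (forall w, w \in S -> r2 <= th 0 w ^+ 2) ->
  2 * Q * r2 <= eps ^+ 2 -> 8 * 100 * Q * L <= c ^+ 2 * N * r2 ->
  Q * X < c / 4 * N * r2 ->
  is_unique_argmin z q gamma v S.
Proof.
move=> X hM X0 hX r20 hr2 re hr hQX; split; first by rewrite inE vS.
move=> J; rewrite inE => /andP[vJ Jq] JS; rewrite /BIC -/N -/X.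
have [SJ|] := boolP (S \subset J); last first.
  case/subsetPn => w wS wJ.
  have h1 : sup (range (loglik z J v)) <= ll z v th - c / 8 * N * r2.
    apply: sup_loglik_le => u su.
    exact: (missed_signal vJ Jq su wS wJ r20 (hr2 w wS) re hr).
  have h2 := ll_le_sup z v sth.
  have h3 : #|S|%:R * X <= Q * X by rewrite ler_wpM2r// ler_nat.
  have h4 : 0 <= #|J|%:R * X by rewrite mulr_ge0.
  apply: numeric_missed h2 h3 h4 hQX; move: h1; rewrite (_ : c / 8 * N * r2 = c / 4 * N * r2 / 2)//; last by field.
pose K := J :\: S.
have K0 : (0 < #|K|)%N.
  rewrite lt0n cards_eq0; apply: contra JS.
  by rewrite finset.setD_eq0 finset.eqEsubset SJ andbT.
have h1 : sup (range (loglik z J v)) <= ll z v (th + D) +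
    bil H (riesz J H sc - D) (riesz J H sc - D) / (2 * (1 - 3 * eps)) + eps * L.
  by apply: sup_loglik_le => u; exact: ll_nested_le.
have h2 := ll_le_sup z v (supportedD sth newton_supported).
have h3 : bil H (riesz J H sc - D) (riesz J H sc - D) / 2 * (1 - 3 * eps) <= #|K|%:R * (y + C).
  apply: score_grid_le => // M dM V hV; apply: hM => //; rewrite dM//.
  by rewrite inE negb_and vJ orbT.
have k1 : 1 <= #|K|%:R :> R by rewrite ler1n.
have cJ : #|J|%:R = #|S|%:R + #|K|%:R :> R.
  by rewrite -natrD /K cardsD (finset.setIidPr SJ) subnKC// subset_leq_card.
rewrite cJ; apply: numeric_nested eps01 L0 k1 h1 h2 h3 hX.
Qed.

End Deterministic.

(** * Probability on the finite sample space and resampling of one spin *)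

Section FiniteProbability.
Variables (R : realType) (p n : nat) (pi : config p -> R).
Hypothesis pi_ge0 : forall c, 0 <= pi c.
Hypothesis pi_sum : \sum_c pi c = 1.

Notation sample := {ffun 'I_n -> config p}.
Implicit Types (zz : sample) (F G : sample -> R) (A B : sample -> Prop).

Definition sprob zz : R := \prod_i pi (zz i).

Definition esp F : R := \sum_zz sprob zz * F zz.

Definition prob A : R := \sum_(zz | `[< A zz >]) sprob zz.

Lemma sprob_ge0 zz : 0 <= sprob zz.
Proof. exact: prodr_ge0. Qed.

Lemma esp_prod (g : config p -> R) :
  esp (fun zz => \prod_i g (zz i)) = (\sum_c pi c * g c) ^+ n.
Proof.
rewrite /esp /sprob.
under eq_bigr do rewrite -big_split /=.
by rewrite -(bigA_distr_bigA (fun (_ : 'I_n) c => pi c * g c)) prodr_const card_ord.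
Qed.

Lemma prob_total : \sum_zz sprob zz = 1.
Proof.
have := esp_prod (fun=> 1).
rewrite [X in _ = X ^+ _](eq_bigr pi); last by move=> c _; rewrite mulr1.
rewrite pi_sum expr1n /esp => h; rewrite -[RHS]h.
by apply: eq_bigr => zz _; rewrite big1 ?mulr1.
Qed.

Lemma probC A : prob (fun zz => ~ A zz) = 1 - prob A.
Proof.
rewrite -prob_total (bigID (fun zz => `[< A zz >]))/= -/(prob A) addrAC subrr add0r.
by apply: eq_bigl => zz; rewrite asbool_neg.
Qed.

Lemma prob_sub A B : (forall zz, A zz -> B zz) -> prob A <= prob B.
Proof.
move=> AB; rewrite /prob [leLHS]big_mkcond [leRHS]big_mkcond /=.
apply: ler_sum => zz _; case: ifPn => [/asboolP/AB/asboolP ->//|_].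
by case: ifP => // _; exact: sprob_ge0.
Qed.

Lemma prob_or A B : prob (fun zz => A zz \/ B zz) <= prob A + prob B.
Proof.
rewrite /prob [leLHS]big_mkcond [X in _ <= X + _]big_mkcond [X in _ <= _ + X]big_mkcond /= -big_split /=; apply: ler_sum => zz _.
have := sprob_ge0 zz; rewrite asbool_or.
by case: ifP; case: ifP; case: ifP => //=; lra.
Qed.

Lemma prob_exists (I : finType) (Q : pred I) (A : I -> sample -> Prop) :
  prob (fun zz => exists2 i, Q i & A i zz) <= \sum_(i | Q i) prob (A i).
Proof.
rewrite /prob (exchange_big_dep predT)//= [leLHS]big_mkcond; apply: ler_sum => zz _.
case: ifPn => [/asboolP[i Qi Ai]|_]; last by apply: sumr_ge0 => i _; exact: sprob_ge0.
rewrite (bigD1 i)/=; last by rewrite Qi; apply/asboolP.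
by rewrite lerDl; apply: sumr_ge0 => j _; exact: sprob_ge0.
Qed.

Lemma exp_markov (G : sample -> R) (t : R) :
  esp (fun zz => expR (G zz)) <= 1 -> prob (fun zz => t < G zz) <= expR (- t).
Proof.
move=> h; apply: (@le_trans _ _ (expR (- t) * esp (fun zz => expR (G zz)))); last first.
  by rewrite ler_piMr// expR_ge0.
rewrite /prob /esp big_mkcond /= mulr_sumr; apply: ler_sum => zz _.
have s0 := sprob_ge0 zz.
case: ifPn => [/asboolP tG|_]; last by rewrite !mulr_ge0// expR_ge0.
rewrite mulrCA ler_peMr// -expRD -expR0 ler_expR; lra.
Qed.

Lemma expR_le_quad (x : R) : `|x| <= 1 / 2 -> expR x <= 1 + x + 2 * x ^+ 2.
Proof.
rewrite ler_norml => /andP[x1 x2]; have := expR_ge1Dx (- x); have := expR_gt0 x => h1 h2.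
have e1 : expR x * expR (- x) = 1 by rewrite -expRD subrr expR0.
have h3 : expR x * (1 - x) <= 1 by rewrite -[leRHS]e1 ler_pM2l.
rewrite -(@ler_pM2r _ (1 - x)); last by lra.
apply: le_trans h3 _.
have : 0 <= x ^+ 2 * (1 - 2 * x) by rewrite mulr_ge0 ?sqr_ge0//; lra.
by lra.
Qed.

(** Since |f - m| <= 2 and lam <= 1 / 4, the exponent stays within 1 / 2, where e^x <= 1 + x + 2
    x^2. The linear term has mean 0 and the quadratic one is at most 8 lam^2. *)
Lemma iid_mgf (f : config p -> R) (lam : R) : (forall c, `|f c| <= 1) ->
  0 <= lam <= 1 / 4 ->
  esp (fun zz => expR (lam * (\sum_i f (zz i) - n%:R * \sum_c pi c * f c)
                       - 8 * n%:R * lam ^+ 2)) <= 1.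
Proof.
move=> f1 /andP[l0 l1]; set m := \sum_c _.
have m1 : `|m| <= 1.
  apply: le_trans (ler_norm_sum _ _ _) _; rewrite -pi_sum; apply: ler_sum => c _.
  by rewrite normrM ger0_norm// ler_piMr.
pose g c := expR (lam * (f c - m) - 8 * lam ^+ 2).
have -> : (fun zz : sample => expR (lam * (\sum_i f (zz i) - n%:R * m) - 8 * n%:R * lam ^+ 2))
  = (fun zz => \prod_i g (zz i)).
  apply/funext => zz; rewrite /g -expR_sum; congr expR.
  rewrite sumrB -mulr_sumr sumrB !sumr_const card_ord -[m *+ n]mulr_natl -[_ *+ n]mulr_natl.
  ring.
rewrite esp_prod; apply: exprn_ile1.
  by apply: sumr_ge0 => c _; rewrite mulr_ge0// expR_ge0.
have -> : \sum_c pi c * g c = expR (- (8 * lam ^+ 2)) * \sum_c pi c * expR (lam * (f c - m)).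
  by rewrite mulr_sumr; apply: eq_bigr => c _; rewrite /g expRD; ring.
rewrite -[leRHS](_ : expR (- (8 * lam ^+ 2)) * expR (8 * lam ^+ 2) = 1); last first.
  by rewrite -expRD addNr expR0.
rewrite ler_pM2l ?expR_gt0//; apply: le_trans (expR_ge1Dx _).
apply: (@le_trans _ _ (\sum_c pi c * (1 + lam * (f c - m) + 8 * lam ^+ 2))).
  apply: ler_sum => c _; rewrite ler_wpM2l//.
  have d2 : `|f c - m| <= 2.
    by apply: le_trans (ler_normB _ _) _; have := f1 c; lra.
  have d3 : `|lam * (f c - m)| <= 1 / 2.
    rewrite normrM (ger0_norm l0).
    by apply: (@le_trans _ _ (1 / 4 * 2)); [exact: ler_pM|lra].
  apply: le_trans (expR_le_quad d3) _; rewrite lerD2l exprMn.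
  have d4 : (f c - m) ^+ 2 <= 4.
    rewrite -[leLHS]real_normK ?num_real//.
    by apply: (@le_trans _ _ (2 ^+ 2)); [rewrite ler_sqr ?nnegrE|lra].
  have : lam ^+ 2 * (f c - m) ^+ 2 <= lam ^+ 2 * 4 by rewrite ler_wpM2l ?sqr_ge0.
  by lra.
rewrite le_eqVlt; apply/orP; left; apply/eqP.
rewrite (eq_bigr (fun c => pi c * (1 - lam * m + 8 * lam ^+ 2) + lam * (pi c * f c))).
  by rewrite big_split /= -mulr_suml pi_sum -mulr_sumr -/m; ring.
by move=> c _; ring.
Qed.

Variables (v : 'I_p) (th : 'rV[R]_p).

Definition setv (c : config p) (b : bool) : config p :=
  [ffun j => if j == v then b else c j].

(** The Bernoulli probability of response b at log-odds x. *)
Definition pcond (x : R) (b : bool) : R := expR ((if b then x else 0) - softplus x).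

Hypothesis th_v : th 0 v = 0.
(** Detailed balance: given the other spins, the one at v is Bernoulli with log-odds [dot c th]. *)
Hypothesis balance : forall c b,
  pi c * pcond (dot c th) b = pi (setv c b) * pcond (dot c th) (c v).

Definition resample zz (y : {ffun 'I_n -> bool}) : sample :=
  [ffun i => setv (zz i) (y i)].

Lemma spin_setv (c : config p) b j : j != v -> spin R (setv c b) j = spin R c j.
Proof. by move=> jv; rewrite /spin ffunE (negbTE jv). Qed.

Lemma dot_setv (c : config p) b (u : 'rV[R]_p) : u 0 v = 0 -> dot (setv c b) u = dot c u.
Proof.
move=> u0; rewrite /dot; apply: eq_bigr => j _.
by have [->|jv] := eqVneq j v; rewrite ?u0 ?mulr0// spin_setv.
Qed.

Lemma expR_softplus (x : R) : expR (softplus x) = 1 + expR x.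
Proof. by rewrite /softplus lnK// posrE onepexp_gt0. Qed.

Lemma pcond_sum x : pcond x true + pcond x false = 1.
Proof.
rewrite /pcond sub0r expRD -[X in _ + X]mul1r -mulrDl addrC -[1]expR0.
by rewrite expR0 -expR_softplus -expRD subrr expR0.
Qed.

(** Exchanging the old and the fresh spins at v is an involution on pairs, and [balance] says that
    it preserves their joint weight. *)
Lemma resample_inv F : esp F = \sum_zz sprob zz *
  \sum_(y : {ffun 'I_n -> bool}) (\prod_i pcond (dot (zz i) th) (y i)) * F (resample zz y).
Proof.
transitivity (\sum_zz \sum_(y : {ffun 'I_n -> bool})
    sprob zz * (\prod_i pcond (dot (zz i) th) (y i)) * F zz).
  apply: eq_bigr => zz _; rewrite -mulr_suml -mulr_sumr.
  rewrite -(bigA_distr_bigA (fun i b => pcond (dot (zz i) th) b)) big1 ?mulr1//.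
  by move=> i _; rewrite big_bool /= pcond_sum.
under [RHS]eq_bigr do rewrite mulr_sumr.
rewrite [LHS]pair_bigA [RHS]pair_bigA /=.
pose h (zy : sample * {ffun 'I_n -> bool}) : sample * {ffun 'I_n -> bool} :=
  (resample zy.1 zy.2, [ffun i => zy.1 i v]).
have hK : involutive h.
  move=> [zz y]; congr pair; apply/ffunP => i; rewrite !ffunE; last by rewrite eqxx.
  by apply/ffunP => j; rewrite !ffunE; case: eqP => // ->.
rewrite (reindex_inj (inv_inj hK)) /=; apply: eq_bigr => -[zz y] _ /=.
rewrite [RHS]mulrA; apply: (f_equal (fun X : R => X * F (resample zz y))).
rewrite /sprob -!big_split /=; apply: eq_bigr => i _.
by rewrite !ffunE dot_setv// balance.
Qed.

(** The centred moment is exactly the exponential of softplus (x + a) - softplus x - a sigm x. Its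
    Taylor bound has the true variance up to e^eps, which keeps the leading constant sharp. *)
Lemma bernoulli_mgf_le (x a eps : R) : `|a| <= eps ->
  \sum_(b : bool) pcond x b *
    expR (a * ((if b then 1 else 0) - sigm x) - expR eps / 2 * (svar x * a ^+ 2)) <= 1.
Proof.
move=> ae; rewrite big_bool /pcond -!expRD.
have -> : x - softplus x + (a * (1 - sigm x) - expR eps / 2 * (svar x * a ^+ 2)) =
  (x + a) + (- softplus x - a * sigm x - expR eps / 2 * (svar x * a ^+ 2)) by ring.
have -> : 0 - softplus x + (a * (0 - sigm x) - expR eps / 2 * (svar x * a ^+ 2)) =
  - softplus x - a * sigm x - expR eps / 2 * (svar x * a ^+ 2) by ring.
set k := - softplus x - _ - _.
rewrite expRD -[X in _ + X <= _]mul1r -mulrDl [expR _ + 1]addrC -expR_softplus /k.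
rewrite -expRD -[leRHS]expR0 ler_expR.
have := softplus_taylor_le x a.
have : svar x * expR `|a| * a ^+ 2 <= svar x * expR eps * a ^+ 2.
  by rewrite ler_wpM2r ?sqr_ge0// ler_pM2l ?svar_gt0// ler_expR.
by lra.
Qed.

(* Conditionally on the other spins, the responses are independent Bernoulli
   variables, and the direction V may depend on those other spins. *)
Lemma score_mgf (V : sample -> 'rV[R]_p) (eps : R) :
  (forall zz y, V (resample zz y) = V zz) -> (forall zz, V zz 0 v = 0) ->
  (forall zz i, `|dot (zz i) (V zz)| <= eps) ->
  esp (fun zz => expR (pairing (score zz v th) (V zz)
    - expR eps / 2 * bil (hess zz th) (V zz) (V zz))) <= 1.
Proof.
move=> Vinv Vv Vs; rewrite resample_inv.
rewrite -[leRHS]prob_total; apply: ler_sum => zz _.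
rewrite ler_piMr ?sprob_ge0//.
pose g i (b : bool) := pcond (dot (zz i) th) b * expR (dot (zz i) (V zz) *
   ((if b then 1 else 0) - sigm (dot (zz i) th))
    - expR eps / 2 * (svar (dot (zz i) th) * dot (zz i) (V zz) ^+ 2)).
rewrite (eq_bigr (fun y : {ffun 'I_n -> bool} => \prod_i g i (y i))).
  rewrite -(bigA_distr_bigA g); apply: prodr_ile1 => i _.
  apply/andP; split; last exact: bernoulli_mgf_le.
  by apply: sumr_ge0 => b _; rewrite mulr_ge0 ?expR_ge0.
move=> y _; rewrite /g big_split /=; congr (_ * _).
rewrite -expR_sum; congr expR.
rewrite score_pairing hessE mulr_sumr -sumrB; apply: eq_bigr => i _.
rewrite Vinv /fitted /response !ffunE !dot_setv//.
have -> : (spin R (setv (zz i) (y i)) v + 1) / 2 = (if y i then 1 else 0).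
  by rewrite /spin ffunE eqxx; case: ifP => _; [field|rewrite addNr mul0r].
by rewrite expr2 [dot _ _ * (_ - _)]mulrC !mulrA.
Qed.

End FiniteProbability.

(** * The Ising model conditionally on all spins but one *)

Section IsingConditional.
Variables (R : realType) (p : nat) (M : ising_model R p).

(** The factor 2 turns spin energies into log-odds. *)
Definition cond_param (v : 'I_p) : 'rV[R]_p :=
  \row_w (if w \in ne M v then 2 * inter M v w else 0).

Lemma ne_irr v : v \notin ne M v.
Proof. by rewrite inE edge_irr. Qed.

Lemma cond_param_supported v : supported (ne M v) (cond_param v).
Proof. by move=> w wv; rewrite mxE (negbTE wv). Qed.

Lemma cond_param_self v : cond_param v 0 v = 0.
Proof. exact/cond_param_supported/ne_irr. Qed.

Definition energy (c : config p) : R :=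
  \sum_(a < p) \sum_(b < p | (a < b)%N && edge M a b) inter M a b * spin R c a * spin R c b.

(** [h] collects the edges that avoid v, so it keeps its value when the spin at v changes. Halving
    the predictor undoes the factor 2 of [cond_param]. *)
Lemma energy_split (c : config p) v : exists2 h : config p -> R,
  energy c = spin R c v * dot c (cond_param v) / 2 + h c
  & forall b, energy (setv v c b) = spin R (setv v c b) v * dot c (cond_param v) / 2 + h c.
Proof.
pose G (c : config p) (a b : 'I_p) : R :=
  if (a < b)%N && edge M a b then inter M a b * spin R c a * spin R c b else 0.
pose h c := \sum_(a < p | a != v) \sum_(b < p | b != v) G c a b.
have E c' : energy c' = spin R c' v * dot c' (cond_param v) / 2 + h c'.
  rewrite /energy (eq_bigr (fun a => \sum_(b < p) G c' a b)); last first.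
    by move=> a _; rewrite big_mkcond.
  rewrite (bigD1 v)//= [X in _ + X](eq_bigr (fun a => G c' a v + \sum_(b < p | b != v) G c' a b)); last first.
    by move=> a _; rewrite (bigD1 v).
  rewrite big_split /= addrA; congr (_ + _).
  rewrite (bigD1 v)//= {1}/G ltnn /= add0r -big_split /=.
  have -> : dot c' (cond_param v) = \sum_(b < p | b != v) spin R c' b * cond_param v 0 b.
    by rewrite /dot (bigD1 v)//= cond_param_self mulr0 add0r.
  rewrite mulr_sumr mulr_suml.
  apply: eq_bigr => b bv; rewrite /G mxE inE [edge M b v]edge_sym [inter M b v]inter_sym.
  case: (ltngtP v b) => [h1|h1|/val_inj h1] /=; last by rewrite h1 eqxx in bv.
  - by case: ifP => _; field.
  - by case: ifP => _; field.
exists h => [|b]; first exact: E.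
rewrite E dot_setv ?cond_param_self//; congr (_ + _).
apply: eq_bigr => a av; apply: eq_bigr => b' bv.
by rewrite /G !spin_setv.
Qed.

Lemma ising_balance v (c : config p) b :
  ising_pmf M c * pcond (dot c (cond_param v)) b =
  ising_pmf M (setv v c b) * pcond (dot c (cond_param v)) (c v).
Proof.
rewrite /ising_pmf ![_ / _ * _]mulrAC; congr (_ / _).
rewrite /ising_weight -/(energy c) -/(energy (setv v c b)) /pcond -!expRD.
have [h -> ->] := energy_split c v; congr expR.
by rewrite /spin ffunE eqxx; case: b; case: (c v); field.
Qed.

Lemma ising_pmf_ge0 c : 0 <= ising_pmf M c.
Proof. by rewrite divr_ge0 ?expR_ge0// sumr_ge0// => ? _; exact: expR_ge0. Qed.

Lemma ising_pmf_sum : \sum_c ising_pmf M c = 1.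
Proof.
rewrite /ising_pmf -mulr_suml divff// gt_eqF//.
rewrite (bigD1 [ffun=> true])//= ltr_wpDr ?expR_gt0//.
by apply: sumr_ge0 => ? _; exact: expR_ge0.
Qed.

End IsingConditional.

(** * Bounds on the mean Hessian from the moment conditions *)

Section Population.
Variables (R : realType) (p k : nat) (pi : config p -> R) (b1 b2 : R).
Hypothesis pi_ge0 : forall c, 0 <= pi c.
Hypothesis pi_sum : \sum_c pi c = 1.
Hypothesis b1_gt0 : 0 < b1.
Hypothesis b2_gt0 : 0 < b2.
Hypothesis second : forall J (u : 'rV[R]_p), supported J u -> (#|J| <= k)%N ->
  sqn u = 1 -> b1 <= \sum_c pi c * dot c u ^+ 2.
Hypothesis third : forall J (u : 'rV[R]_p), supported J u -> (#|J| <= k)%N ->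
  sqn u = 1 -> \sum_c pi c * `|dot c u| ^+ 3 <= b2.

Lemma unit_direction (u : 'rV[R]_p) : u != 0 ->
  exists2 t : R, 0 < t & t ^+ 2 = sqn u /\ sqn (t^-1 *: u) = 1.
Proof.
move=> u0; have s0 : 0 < sqn u.
  by rewrite lt_neqAle sqn_ge0 andbT eq_sym; apply: contra u0 => /eqP/sqn_eq0 ->.
exists (Num.sqrt (sqn u)); first by rewrite sqrtr_gt0.
have h : Num.sqrt (sqn u) ^+ 2 = sqn u by rewrite sqr_sqrtr// ltW.
by split=> //; rewrite sqnZ exprVn h mulVf// gt_eqF.
Qed.

Lemma third_scaled J (u : 'rV[R]_p) (t : R) : supported J u -> (#|J| <= k)%N ->
  0 <= t -> sqn u <= t ^+ 2 -> \sum_c pi c * `|dot c u| ^+ 3 <= b2 * t ^+ 3.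
Proof.
move=> su Jk t0 ut; have [->|u0] := eqVneq u 0.
  by rewrite big1 ?mulr_ge0 ?exprn_ge0 ?(ltW b2_gt0)// => c _; rewrite dot0 normr0 expr0n mulr0.
have [s s0 [s2 su1]] := unit_direction u0.
have h := third (supportedZ s^-1 su) Jk su1.
have -> : \sum_c pi c * `|dot c u| ^+ 3 = s ^+ 3 * \sum_c pi c * `|dot c (s^-1 *: u)| ^+ 3.
  rewrite mulr_sumr; apply: eq_bigr => c _.
  rewrite dotZ normrM (@gtr0_norm _ s^-1) ?invr_gt0// exprMn exprVn.
  by field; rewrite gt_eqF.
have st : s <= t by rewrite -ler_sqr ?nnegrE ?(ltW s0)// s2.
rewrite mulrC; apply: ler_pM => //.
- by apply: sumr_ge0 => c _; rewrite mulr_ge0// exprn_ge0.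
- by rewrite exprn_ge0// ltW.
- by rewrite lerXn2r// nnegrE ltW.
Qed.

Lemma sqr_le_cube (x : R) : x ^+ 2 <= 1 + `|x| ^+ 3.
Proof.
rewrite -[x ^+ 2]real_normK ?num_real//; have := normr_ge0 x; move: `|x| => y y0.
have [y1|y1] := lerP y 1.
  by rewrite (@le_trans _ _ 1) ?expr_le1// lerDl exprn_ge0.
by rewrite (@le_trans _ _ (y ^+ 3)) ?lerDr// ler_weXn2l// ltW.
Qed.

(** For |y| <= B the variance is at least e^(-B) / 4. For |y| > B the left side is nonpositive, as
    x^2 <= |x|^3 / T + T^2 and |y|^3 / B >= 1. Cubes are used so that the mean calls on third
    moments only. *)
Lemma truncation (x y B T : R) : 0 < T -> 1 <= B ->
  expR (- B) / 4 * (x ^+ 2 - `|x| ^+ 3 / T - T ^+ 2 * (`|y| ^+ 3 / B)) <= svar y * x ^+ 2.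
Proof.
move=> T0 B1; have B0 : 0 < B by lra.
have k0 : 0 < expR (- B) / 4 by rewrite divr_gt0 ?expR_gt0.
have h1 : 0 <= `|x| ^+ 3 / T by rewrite divr_ge0 ?exprn_ge0// ltW.
have h2 : 0 <= T ^+ 2 * (`|y| ^+ 3 / B).
  by rewrite mulr_ge0 ?sqr_ge0// divr_ge0 ?exprn_ge0// ltW.
have [yB|yB] := lerP `|y| B.
  apply: (@le_trans _ _ (expR (- B) / 4 * x ^+ 2)); first by rewrite ler_pM2l//; lra.
  rewrite ler_wpM2r ?sqr_ge0//; apply: le_trans (svar_ge y).
  by rewrite ler_pM2r// ler_expR lerN2.
apply: (@le_trans _ _ 0); last by rewrite mulr_ge0 ?sqr_ge0// ltW// svar_gt0.
rewrite pmulr_rle0//.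
have h3 : T ^+ 2 <= T ^+ 2 * (`|y| ^+ 3 / B).
  rewrite ler_peMr ?sqr_ge0// ler_pdivlMr// mul1r.
  apply: (@le_trans _ _ `|y|); first exact: ltW.
  by rewrite ler_eXnr//; lra.
have h4 : x ^+ 2 <= `|x| ^+ 3 / T + T ^+ 2.
  rewrite -[x ^+ 2]real_normK ?num_real//; have := normr_ge0 x; move: `|x| h1 => a h1 a0.
  have [aT|aT] := lerP a T.
    by rewrite (@le_trans _ _ (T ^+ 2)) ?lerDr// lerXn2r// nnegrE// ltW.
  rewrite (@le_trans _ _ (a ^+ 3 / T)) ?lerDl ?sqr_ge0// ler_pdivlMr// [leRHS]exprSr.
  by rewrite ler_wpM2l ?sqr_ge0// ltW.
lra.
Qed.

(** This level and the next make each of the two truncation losses at most b1 / 4 in a unit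
    direction. *)
Definition trunc_level : R := 4 * b2 / b1.

Definition logit_level (b0 : R) : R :=
  1 + trunc_level ^+ 2 * b2 * (2 * b0) ^+ 3 * 4 / b1.

Lemma population_lower (b0 : R) J S (th u : 'rV[R]_p) : 0 < b0 ->
  supported S th -> (#|S| <= k)%N -> sqn th <= (2 * b0) ^+ 2 ->
  supported J u -> (#|J| <= k)%N ->
  expR (- logit_level b0) / 4 * (b1 / 2) * sqn u <=
    \sum_c pi c * (svar (dot c th) * dot c u ^+ 2).
Proof.
move=> b00 sth Sk th2 su Jk.
set B := logit_level b0; set T := trunc_level.
have T0 : 0 < T by rewrite divr_gt0// mulr_gt0.
have X0 : 0 <= T ^+ 2 * b2 * (2 * b0) ^+ 3 * 4 / b1.
  have b00' : 0 <= 2 * b0 by rewrite mulr_ge0// ltW.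
  by rewrite !mulr_ge0 ?sqr_ge0 ?exprn_ge0 ?invr_ge0 ?mulr_ge0 ?(ltW b1_gt0) ?(ltW b2_gt0) ?(ltW b00).
have B1 : 1 <= B by rewrite lerDl.
have [->|u0] := eqVneq u 0.
  rewrite (_ : sqn 0 = 0); last by rewrite /sqn big1// => j _; rewrite mxE expr0n.
  rewrite mulr0; apply: sumr_ge0 => c _.
  by rewrite mulr_ge0// mulr_ge0 ?sqr_ge0// ltW// svar_gt0.
have [s s0 [s2 su1]] := unit_direction u0.
set u' := s^-1 *: u in su1; have su' : supported J u' := supportedZ s^-1 su.
have -> : \sum_c pi c * (svar (dot c th) * dot c u ^+ 2) =
    \sum_c pi c * (svar (dot c th) * dot c u' ^+ 2) * sqn u.
  apply: eq_bigr => c _; rewrite dotZ exprMn -s2 exprVn; field; exact: lt0r_neq0.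
rewrite -mulr_suml ler_wpM2r ?sqn_ge0//.
have h2 := second su' Jk su1; have h3 := third su' Jk su1.
have h4 : \sum_c pi c * `|dot c th| ^+ 3 <= b2 * (2 * b0) ^+ 3.
  by apply: third_scaled sth Sk _ th2; rewrite mulr_ge0// ltW.
have k0 : 0 < expR (- B) / 4 by rewrite divr_gt0 ?expR_gt0.
apply: (@le_trans _ _ (expR (- B) / 4 * (\sum_c pi c * dot c u' ^+ 2
   - (\sum_c pi c * `|dot c u'| ^+ 3) / T - T ^+ 2 * ((\sum_c pi c * `|dot c th| ^+ 3) / B)))).
  rewrite ler_pM2l//.
  have h5 : (\sum_c pi c * `|dot c u'| ^+ 3) / T <= b1 / 4.
    apply: (@le_trans _ _ (b2 / T)); first by rewrite ler_pM2r ?invr_gt0.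
    by rewrite /T /trunc_level le_eqVlt; apply/orP; left; apply/eqP; field; rewrite !gt_eqF.
  have h6 : T ^+ 2 * ((\sum_c pi c * `|dot c th| ^+ 3) / B) <= b1 / 4.
    rewrite mulrA ler_pdivrMr; last by lra.
    apply: (@le_trans _ _ (T ^+ 2 * (b2 * (2 * b0) ^+ 3))).
      by rewrite ler_wpM2l ?sqr_ge0.
    have -> : T ^+ 2 * (b2 * (2 * b0) ^+ 3) = b1 / 4 * (B - 1).
      by rewrite /B /logit_level -/T; field; rewrite gt_eqF.
    by rewrite ler_wpM2l ?gerBl// divr_ge0// ltW.
  lra.
rewrite !mulr_suml mulr_sumr -!sumrB mulr_sumr; apply: ler_sum => c _.
have := truncation (dot c u') (dot c th) T0 B1.
move/(ler_wpM2l (pi_ge0 c)); apply: le_trans.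
by rewrite le_eqVlt; apply/orP; left; apply/eqP; ring.
Qed.

Lemma population_upper J (th u : 'rV[R]_p) : supported J u -> (#|J| <= k)%N ->
  \sum_c pi c * (svar (dot c th) * dot c u ^+ 2) <= (1 + b2) * sqn u.
Proof.
move=> su Jk; have [->|u0] := eqVneq u 0.
  rewrite big1 ?mulr_ge0 ?sqn_ge0//; first by rewrite addr_ge0// ltW.
  by move=> c _; rewrite dot0 expr0n !mulr0.
have [s s0 [s2 su1]] := unit_direction u0.
set u' := s^-1 *: u in su1; have su' : supported J u' := supportedZ s^-1 su.
have -> : \sum_c pi c * (svar (dot c th) * dot c u ^+ 2) =
    \sum_c pi c * (svar (dot c th) * dot c u' ^+ 2) * sqn u.
  apply: eq_bigr => c _; rewrite dotZ exprMn -s2 exprVn; field; exact: lt0r_neq0.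
rewrite -mulr_suml ler_wpM2r ?sqn_ge0//.
apply: (@le_trans _ _ (\sum_c (pi c + pi c * `|dot c u'| ^+ 3))); last first.
  by rewrite big_split /= pi_sum lerD2l; exact: third su' Jk su1.
apply: ler_sum => c _; rewrite -{2}[pi c]mulr1 -mulrDr ler_wpM2l//.
apply: le_trans (sqr_le_cube _); rewrite ler_piMl ?sqr_ge0//.
by apply: le_trans (svar_le _) _; lra.
Qed.

End Population.

(** * Total Gaussian weight of the grid *)

Lemma sum_option (R : nmodType) (T : finType) (h : option T -> R) :
  \sum_o h o = h None + \sum_t h (Some t).
Proof.
rewrite (bigD1 None)//=; congr (_ + _).
rewrite (reindex_omap Some id) /=; last by case.
by apply: eq_bigl => t; rewrite eqxx.
Qed.

Lemma geometric_le (R : realType) (r : R) (m : nat) : 0 <= r < 1 ->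
  \sum_(k < m) r ^+ k <= (1 - r)^-1.
Proof.
move=> /andP[r0 r1]; have h : 0 < 1 - r by lra.
rewrite -[leRHS]mul1r ler_pdivlMr// mulrC.
have := subrX1 r m; rewrite -opprB -[r - 1]opprB mulNr => /oppr_inj <-.
by rewrite gerBl exprn_ge0.
Qed.

Section GridMass.
Variables (R : realType) (p n : nat) (s y : R).
Hypothesis s0 : 0 < s.

Definition grid_const : R := 2 / (1 - expR (- s)).

Lemma grid_const_ge0 : 0 <= grid_const.
Proof. by rewrite divr_ge0// subr_ge0 -expR0 ler_expR oppr_le0 ltW. Qed.

(** k^2 >= k replaces the Gaussian sum by a geometric one; the 2 in [grid_const] counts signs. *)
Lemma gval_mass :
  \sum_(g : bool * 'I_n.+1) expR (- (y + s * gval R (Some g) ^+ 2)) <=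
  expR (- y) * grid_const.
Proof.
rewrite (eq_bigr (fun g : bool * 'I_n.+1 => expR (- y) * expR (- s * (g.2%:R ^+ 2)))); last first.
  move=> [b k] _ /=; rewrite -expRD; congr expR.
  by case: b; rewrite ?sqrrN; ring.
rewrite -mulr_sumr ler_pM2l ?expR_gt0//.
have -> : \sum_(g : bool * 'I_n.+1) expR (- s * g.2%:R ^+ 2) =
    \sum_(b : bool) \sum_(k < n.+1) expR (- s * k%:R ^+ 2).
  by rewrite pair_bigA.
rewrite sumr_const card_bool -[leLHS]mulr_natl /grid_const ler_pM2l//.
apply: le_trans (@geometric_le R (expR (- s)) n.+1 _); last first.
  by rewrite expR_ge0 -[ltRHS]expR0 ltr_expR oppr_lt0.
apply: ler_sum => k _; rewrite -expRM_natl ler_expR mulNr mulrN lerN2 mulrC ler_pM2l//.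
by rewrite -natrX ler_nat; case: (val k) => // j; rewrite expnS leq_pmulr// expn_gt0.
Qed.

(** The sum factorises over coordinates into a p-th power of 1 plus the mass of [gval_mass], less 1
    for the empty support. All supports J \ S are thus counted at once. *)
Lemma grid_mass :
  \sum_(M : {ffun 'I_p -> option (bool * 'I_n.+1)} | (0 < #|gdom M|)%N)
    expR (- (#|gdom M|%:R * y + s * gcost R M)) <=
  expR (p%:R * (expR (- y) * grid_const)) - 1.
Proof.
pose h (g : option (bool * 'I_n.+1)) : R :=
  if g is Some _ then expR (- (y + s * gval R g ^+ 2)) else 1.
have hE M : expR (- (#|gdom M|%:R * y + s * gcost R M)) = \prod_j h (M j).
  have -> : \prod_j h (M j) =
     \prod_j expR (- ((if M j then y else 0) + s * gval R (M j) ^+ 2)).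
    apply: eq_bigr => j _; case: (M j) => [g|]; first by [].
    by rewrite /h /= expr0n /= mulr0 addr0 oppr0 expR0.
  rewrite -expR_sum; congr expR; rewrite sumrN big_split /= -mulr_sumr; congr (- (_ + _)).
  rewrite -big_mkcond /= sumr_const -[RHS]mulr_natl; congr (_%:R * _).
  by apply: eq_card => j; rewrite inE [RHS]/in_mem /=; case: (M j).
under eq_bigr do rewrite hE.
have -> : \sum_(M : {ffun 'I_p -> option (bool * 'I_n.+1)} | (0 < #|gdom M|)%N) \prod_j h (M j)
   = \sum_(M : {ffun 'I_p -> option (bool * 'I_n.+1)}) \prod_j h (M j) - 1.
  rewrite [in RHS](bigD1 [ffun=> None])//= [X in X + _ - _](_ : _ = 1); last first.
    by rewrite big1// => j _; rewrite ffunE.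
  rewrite addrAC subrr add0r; apply: eq_bigl => M.
  rewrite lt0n cards_eq0; congr (~~ _); apply/eqP/eqP => [h0|->].
    apply/ffunP => j; rewrite ffunE; have : j \notin gdom M by rewrite h0 inE.
    by rewrite inE negbK => /eqP.
  by apply/setP => j; rewrite !inE ffunE.
rewrite lerD2r -(bigA_distr_bigA (fun _ => h)) prodr_const card_ord sum_option /=.
have h0 := gval_mass.
rewrite expRM_natl; apply: lerXn2r; rewrite ?nnegrE ?expR_ge0//.
  by rewrite addr_ge0// sumr_ge0// => g _; exact: expR_ge0.
by apply: le_trans (expR_ge1Dx _); rewrite lerD2l.
Qed.

End GridMass.

(** * Probability of the good event *)

Section SelectionProbability.
Variables (R : realType) (p n q : nat) (M : ising_model R p).
Variables (b0 b1 b2 L eps : R).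
Implicit Types (v : 'I_p) (J : {set 'I_p}) (u : 'rV[R]_p).
Let N : R := n%:R.
Let Q : R := q%:R.
Let pi := ising_pmf M.
Notation sample := {ffun 'I_n -> config p}.
Notation th := (cond_param M).
Notation grid := {ffun 'I_p -> option (bool * 'I_n.+1)}.

(** Half of the population bound, the other half being left to the sampling deviation; the minimum
    keeps it at most 1. *)
Definition curv_lower : R :=
  Num.min 1 (expR (- logit_level b1 b2 b0) / 4 * (b1 / 2)) / 2.

(** 1 + b2 bounds the population form, and 1 more covers the deviation. *)
Definition curv_upper : R := 2 + b2.

Let c := curv_lower.
Let C := curv_upper.

Hypothesis n0 : (0 < n)%N.
Hypothesis q0 : (0 < q)%N.
Hypothesis L0 : 0 < L.
Hypothesis b00 : 0 < b0.
Hypothesis b10 : 0 < b1.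
Hypothesis b20 : 0 < b2.
Hypothesis eps01 : 0 < eps <= 1 / 8.
Hypothesis degree : forall v, (#|ne M v| <= q)%N.
Hypothesis th_norm : forall v, sqn (th v) <= (2 * b0) ^+ 2.
Hypothesis second : forall J (u : 'rV[R]_p), supported J u -> (#|J| <= 2 * q)%N ->
  sqn u = 1 -> b1 <= \sum_c pi c * dot c u ^+ 2.
Hypothesis third : forall J (u : 'rV[R]_p), supported J u -> (#|J| <= 2 * q)%N ->
  sqn u = 1 -> \sum_c pi c * `|dot c u| ^+ 3 <= b2.
Hypothesis key : 100 * 100 * C * Q ^+ 3 * L <= eps ^+ 2 * c ^+ 3 * N.

Lemma curv_lower_bounds : 0 < c <= 1.
Proof.
rewrite /c /curv_lower; set x := _ / 4 * _.
have x0 : 0 < x by rewrite mulr_gt0 ?divr_gt0 ?expR_gt0.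
have m0 : 0 < Num.min 1 x by rewrite lt_min ltr01.
have m1 : Num.min 1 x <= 1 by rewrite ge_min lexx.
by move: (Num.min 1 x) m0 m1 => y m0 m1; lra.
Qed.

Lemma curv_upper_ge1 : 1 <= C. Proof. by rewrite /C /curv_upper; move: b20; lra. Qed.

Let N0 : 0 < N. Proof. by rewrite ltr0n. Qed.
Let Q1 : 1 <= Q. Proof. by rewrite ler1n. Qed.
Let Q0 : 0 <= Q. Proof. exact: ler0n. Qed.

(* The natural fluctuation scale: N * lam = sqrt (n L). *)
Definition lam : R := Num.sqrt (L / N).

Lemma lam_sqr : lam ^+ 2 = L / N.
Proof. by rewrite sqr_sqrtr// divr_ge0// ltW. Qed.

Lemma lam_gt0 : 0 < lam.
Proof. by rewrite sqrtr_gt0 divr_gt0. Qed.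

Lemma lam_small : 100 * Q * lam <= c.
Proof.
have /andP[c0 c1] := curv_lower_bounds; have C1 := curv_upper_ge1.
have l0 := lam_gt0; have /andP[e0 e1] := eps01.
have P0 : 0 <= 100 * Q * lam by rewrite !mulr_ge0 ?(ltW l0).
rewrite -ler_sqr ?nnegrE ?(ltW c0)// exprMn lam_sqr mulrA ler_pdivrMr//.
apply: (@le_trans _ _ (eps ^+ 2 * c ^+ 3 * N)); last first.
  rewrite ler_pM2r//; apply: (@le_trans _ _ (1 * c ^+ 3)).
    by rewrite ler_pM2r ?exprn_gt0// expr_le1// ?(ltW e0)//; apply: le_trans e1 _; lra.
  by rewrite mul1r exprS ger_pMl ?exprn_gt0.
apply: le_trans key; rewrite ler_pM2r// exprMn.
have -> : 100 ^+ 2 * Q ^+ 2 = 100 * 100 * (1 * Q ^+ 2) by rewrite mul1r [100 ^+ 2]expr2.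
rewrite -[100 * 100 * C * _]mulrA ler_wpM2l//; apply: ler_pM => //.
  by rewrite sqr_ge0.
by rewrite ler_weXn2l.
Qed.

Lemma lam_le : lam <= 1 / 100.
Proof.
have /andP[_ c1] := curv_lower_bounds; have l0 := lam_gt0.
have : 100 * 1 * lam <= 100 * Q * lam by rewrite ler_pM2r// ler_pM2l.
have := lam_small; lra.
Qed.

Definition hess_mean (v : 'I_p) : 'M[R]_p :=
  gram (fun c => pi c * svar (dot c (th v))) (fun c : config p => c).

Lemma hess_meanE v u : bil (hess_mean v) u u =
  \sum_c pi c * (svar (dot c (th v)) * dot c u ^+ 2).
Proof. by rewrite gramE; apply: eq_bigr => x _; rewrite expr2 !mulrA. Qed.

(** Multiplied by [lam] the threshold is 12 L: 8 L pays the quadratic term of [iid_mgf] and 4 L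
    remains, enough for a union over nodes and index pairs. The Boolean is a sign. *)
Definition hess_dev (v : 'I_p) (x : 'I_p * 'I_p * bool) (zz : sample) : Prop :=
  12 * N * lam < (-1) ^+ x.2 * (hess zz (th v) x.1.1 x.1.2 - N * hess_mean v x.1.1 x.1.2).

Lemma hess_dev_prob v x : prob pi (hess_dev v x) <= expR (- (4 * L)).
Proof.
case: x => [[j k] b]; rewrite /hess_dev /=.
pose f (c : config p) : R := (-1) ^+ b * (svar (dot c (th v)) * (spin R c j * spin R c k)).
have f1 c' : `|f c'| <= 1.
  rewrite /f normrM normrX normrN1 expr1n mul1r normrM [X in _ * X]normrM !spin_norm !mulr1.
  by rewrite ger0_norm ?(ltW (svar_gt0 _))// (le_trans (svar_le _))//; lra.
have l0 := lam_gt0; have l1 := lam_le.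
have l01 : 0 <= lam <= 1 / 4 by lra.
have := @iid_mgf R p n pi (ising_pmf_ge0 M) (ising_pmf_sum M) f lam f1 l01.
move/(exp_markov (ising_pmf_ge0 M) (4 * L)); apply: le_trans.
apply: prob_sub; first exact: ising_pmf_ge0.
move=> zz; rewrite -/pi -/N.
have -> : \sum_i f (zz i) = (-1) ^+ b * hess zz (th v) j k.
  by rewrite mxE mulr_sumr.
have -> : \sum_c pi c * f c = (-1) ^+ b * hess_mean v j k.
  by rewrite mxE mulr_sumr; apply: eq_bigr => c' _; rewrite /f; ring.
have -> : 8 * N * lam ^+ 2 = 8 * L by rewrite lam_sqr; field; rewrite gt_eqF.
move=> h.
have -> : (-1) ^+ b * hess zz (th v) j k - N * ((-1) ^+ b * hess_mean v j k) =
  (-1) ^+ b * (hess zz (th v) j k - N * hess_mean v j k) by rewrite mulrBr [N * (_ * _)]mulrCA.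
have := ltr_pM2l l0; move/(_ (12 * N * lam)) => e; rewrite -e in h.
have : lam * (12 * N * lam) = 12 * L.
  have -> : lam * (12 * N * lam) = 12 * N * lam ^+ 2 by ring.
  by rewrite lam_sqr; field; rewrite gt_eqF.
move=> e2; rewrite e2 in h; have L0' := L0; lra.
Qed.

(** An entrywise error changes the form by at most that error times the squared l1 norm, hence by 24
    Q N lam |u|^2 <= c N |u|^2 on 2 q-sparse vectors. *)
Lemma curvature_good v (zz : sample) :
  ~ (exists2 x, xpredT x & hess_dev v x zz) ->
  forall J u, v \notin J -> (#|J| <= 2 * q)%N -> supported J u ->
  c * N * sqn u <= bil (hess zz (th v)) u u <= C * N * sqn u.
Proof.
move=> good J u _ Jq su; have l0 := lam_gt0.
have dev j k : `|hess zz (th v) j k - N * hess_mean v j k| <= 12 * N * lam.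
  rewrite leNgt; apply/negP => h; apply: good.
  have [s|s] := lerP 0 (hess zz (th v) j k - N * hess_mean v j k).
    by exists (j, k, false) => //; rewrite /hess_dev /= expr0 mul1r -(ger0_norm s).
  by exists (j, k, true) => //; rewrite /hess_dev /= expr1 mulN1r -(ltr0_norm s).
have diff : `|bil (hess zz (th v)) u u - N * bil (hess_mean v) u u| <= c * N * sqn u.
  have -> : bil (hess zz (th v)) u u - N * bil (hess_mean v) u u =
      \sum_j \sum_k u 0 j * (hess zz (th v) j k - N * hess_mean v j k) * u 0 k.
    rewrite !bilE mulr_sumr -sumrB; apply: eq_bigr => j _.
    by rewrite mulr_sumr -sumrB; apply: eq_bigr => k _; ring.
  apply: (@le_trans _ _ (12 * N * lam * (\sum_j `|u 0 j|) ^+ 2)).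
    rewrite expr2 big_distrlr /= mulr_sumr; apply: le_trans (ler_norm_sum _ _ _) _.
    apply: ler_sum => j _; rewrite mulr_sumr; apply: le_trans (ler_norm_sum _ _ _) _.
    apply: ler_sum => k _; rewrite !normrM [_ * `|u 0 k|]mulrC mulrC.
    by rewrite mulrA ler_wpM2r// mulrC ler_wpM2r.
  have h : (\sum_j `|u 0 j|) ^+ 2 <= 2 * Q * sqn u.
    apply: le_trans (supported_l1 su) _; rewrite ler_wpM2r ?sqn_ge0//.
    by rewrite /Q -natrM ler_nat.
  apply: (@le_trans _ _ (12 * N * lam * (2 * Q * sqn u))).
    by rewrite ler_wpM2l// !mulr_ge0// ltW.
  have s0 : 0 <= N * sqn u by rewrite mulr_ge0 ?sqn_ge0// ltW.
  have : 100 * Q * lam * (N * sqn u) <= c * (N * sqn u) by rewrite ler_wpM2r ?lam_small.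
  have : 0 <= Q * lam * (N * sqn u) by rewrite mulr_ge0// mulr_ge0// ltW.
  lra.
have lo : 2 * c * sqn u <= bil (hess_mean v) u u.
  have Sq : (#|ne M v| <= 2 * q)%N by rewrite (leq_trans (degree v))// leq_pmull.
  have := population_lower (ising_pmf_ge0 M) b10 b20 second third
    b00 (@cond_param_supported R p M v) Sq (th_norm v) su Jq.
  rewrite hess_meanE; apply: le_trans.
  rewrite ler_wpM2r ?sqn_ge0// /c /curv_lower mulrC divfK ?pnatr_eq0//.
  by rewrite ge_min lexx orbT.
have up : bil (hess_mean v) u u <= (1 + b2) * sqn u.
  rewrite hess_meanE.
  exact: (population_upper (ising_pmf_ge0 M) (ising_pmf_sum M) b20 third _ su Jq).
have /andP[_ c1] := curv_lower_bounds.
have lo' : N * (2 * c * sqn u) <= N * bil (hess_mean v) u u by rewrite ler_pM2l.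
have up' : N * bil (hess_mean v) u u <= N * ((1 + b2) * sqn u) by rewrite ler_pM2l.
have cs : c * (N * sqn u) <= 1 * (N * sqn u).
  by rewrite ler_wpM2r// mulr_ge0 ?sqn_ge0// ltW.
move: b20 diff; rewrite ler_norml /C /curv_upper; lra.
Qed.

(** Coordinate v is left out because its covariate is the response itself. Multiplied by [lam] the
    threshold is 5 L, and the variance term takes at most L / 4. *)
Definition score_dev (v : 'I_p) (x : 'I_p * bool) (zz : sample) : Prop :=
  x.1 != v /\ 5 * N * lam < (-1) ^+ x.2 * score zz v (th v) 0 x.1.

Lemma score_dev_prob v x : prob pi (score_dev v x) <= expR (- (4 * L)).
Proof.
case: x => [j b]; rewrite /score_dev /=.
have [->|jv] := eqVneq j v.
  rewrite /prob big1 ?expR_ge0// => zz; by case: asboolP => // -[].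
have l0 := lam_gt0; have l1 := lam_le.
pose V : 'rV[R]_p := ((-1) ^+ b * lam) *: delta_mx 0 j.
have dV (c' : config p) : dot c' V = (-1) ^+ b * lam * spin R c' j.
  rewrite dotZ /dot (bigD1 j)//= big1 ?mxE ?eqxx ?mulr1 ?addr0// => k kj.
  by rewrite mxE (negbTE kj) mulr0.
have nb : `|(-1) ^+ b| = 1 :> R by rewrite normrX normrN1 expr1n.
have mgf := @score_mgf R p n pi (ising_pmf_ge0 M) (ising_pmf_sum M) v (th v)
  (cond_param_self M v) (ising_balance M v) (fun=> V) lam.
have V1 (zz : sample) : V 0 v = 0 by rewrite !mxE eq_sym (negbTE jv) andbF mulr0.
have V2 (zz : sample) i : `|dot (zz i) V| <= lam.
  by rewrite dV !normrM nb spin_norm mul1r mulr1 gtr0_norm.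
have {}mgf := mgf (fun _ _ => erefl) V1 V2; clear V1.
apply: le_trans (exp_markov (ising_pmf_ge0 M) (4 * L) mgf).
apply: prob_sub; first exact: ising_pmf_ge0.
move=> zz [_ h] /=.
have -> : pairing (score zz v (th v)) V = lam * ((-1) ^+ b * score zz v (th v) 0 j).
  rewrite /V pairingZr /pairing (bigD1 j)//= big1 ?mxE ?eqxx ?mulr1 ?addr0; first ring.
  by move=> k kj; rewrite !mxE (negbTE kj) mulr0.
have hb : bil (hess zz (th v)) V V <= L / 4.
  rewrite hessE; apply: (@le_trans _ _ (\sum_(i < n) 1 / 4 * lam ^+ 2)).
    apply: ler_sum => i _; rewrite -mulrA -expr2 dV !exprMn spin_sqr mulr1.
    rewrite -exprM mulnC exprM sqrrN !expr1n mul1r.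
    by rewrite ler_wpM2r ?sqr_ge0// svar_le.
  rewrite sumr_const card_ord -[leLHS]mulr_natl lam_sqr -/N.
  by rewrite le_eqVlt; apply/orP; left; apply/eqP; field; rewrite gt_eqF.
have el : expR lam <= 2.
  have l2 : 0 <= lam <= 1 / 2 by lra.
  by have := expR_sub1_le l2; lra.
have hb2 : expR lam / 2 * bil (hess zz (th v)) V V <= 1 * (L / 4).
  apply: ler_pM; [by rewrite divr_ge0// expR_ge0|exact: hess_ge0| |exact: hb].
  by rewrite ler_pdivrMr// mul1r.
have h2 : lam * (5 * N * lam) < lam * ((-1) ^+ b * score zz v (th v) 0 j) by rewrite ltr_pM2l.
have e2 : lam * (5 * N * lam) = 5 * L.
  have -> : lam * (5 * N * lam) = 5 * N * lam ^+ 2 by ring.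
  by rewrite lam_sqr; field; rewrite gt_eqF.
move: h2 hb2; rewrite e2; have L0' := L0; lra.
Qed.

Lemma score_good v (zz : sample) :
  ~ (exists2 x, xpredT x & score_dev v x zz) ->
  forall j, j != v -> score zz v (th v) 0 j ^+ 2 <= 25 * N * L.
Proof.
move=> good j jv; have l0 := lam_gt0.
have dev : `|score zz v (th v) 0 j| <= 5 * N * lam.
  rewrite leNgt; apply/negP => h; apply: good.
  have [s|s] := lerP 0 (score zz v (th v) 0 j).
    by exists (j, false) => //; split => //=; rewrite expr0 mul1r -(ger0_norm s).
  by exists (j, true) => //; split => //=; rewrite expr1 mulN1r -(ltr0_norm s).
have -> : 25 * N * L = (5 * N * lam) ^+ 2.
  by rewrite !exprMn lam_sqr; field; rewrite gt_eqF.
rewrite -[leLHS]real_normK ?num_real// ler_sqr ?nnegrE//.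
by rewrite !mulr_ge0// ltW.
Qed.

Definition grid_dir (v : 'I_p) (m : grid) (zz : sample) : 'rV[R]_p :=
  let H := hess zz (th v) in gvec R m - riesz (ne M v) H (gvec R m *m H).

Definition grid_dev (y : R) (v : 'I_p) (m : grid) (zz : sample) : Prop :=
  let V := grid_dir v m zz in
  [/\ v \notin gdom m, forall i, `|dot (zz i) V| <= eps &
   #|gdom m|%:R * y + eps * c * gcost R m <
   pairing (score zz v (th v)) V - expR eps / 2 * bil (hess zz (th v)) V V].

Lemma hess_resample v (zz : sample) yy j k : j != v -> k != v ->
  hess (resample v zz yy) (th v) j k = hess zz (th v) j k.
Proof.
move=> jv kv; rewrite !mxE; apply: eq_bigr => i _.
by rewrite !ffunE !spin_setv// dot_setv// cond_param_self.
Qed.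

(** The grid support and the neighbourhood avoid v, so only Hessian entries off v enter, and neither
    these nor their weights see the spin at v. *)
Lemma grid_dir_resample v m (zz : sample) yy : v \notin gdom m ->
  grid_dir v m (resample v zz yy) = grid_dir v m zz.
Proof.
move=> vm; rewrite /grid_dir; congr (_ - _); rewrite /riesz.
have nev j : j \in ne M v -> j != v by apply: contraTneq => ->; exact: ne_irr.
congr (_ *m invmx _).
  apply/rowP => j; rewrite [LHS]mxE [RHS]mxE; case: ifPn => // /nev jv.
  rewrite [LHS]mxE [RHS]mxE; apply: eq_bigr => k _.
  have [->|kv] := eqVneq k v; first by rewrite (gvec_supported R vm) !mul0r.
  by rewrite hess_resample.
apply/matrixP => j k; rewrite [LHS]mxE [RHS]mxE; case: ifP => // /andP[/nev jv /nev kv].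
exact: hess_resample.
Qed.

Lemma grid_dir_self v m zz : v \notin gdom m -> grid_dir v m zz 0 v = 0.
Proof.
move=> vm; rewrite /grid_dir; set r := riesz _ _ _.
have rv : r 0 v = 0 by exact/riesz_supported/ne_irr.
have gv := gvec_supported R vm.
by move: (gvec R m) gv r rv => g gv r rv; rewrite !mxE gv rv subr0.
Qed.

Lemma grid_dev_prob y v m :
  prob pi (grid_dev y v m) <= expR (- (#|gdom m|%:R * y + eps * c * gcost R m)).
Proof.
have /andP[e0 _] := eps01.
have [vm|vm] := boolP (v \in gdom m).
  rewrite /prob big1 ?expR_ge0// => zz; by case: asboolP => // -[]; rewrite vm.
(* [score_mgf] wants small predictors on every sample, so the direction is set to 0 elsewhere;
   resampling preserves the condition. *)
pose V (zz : sample) := if [forall i, `|dot (zz i) (grid_dir v m zz)| <= eps]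
  then grid_dir v m zz else 0.
have dotr (zz : sample) yy i : dot (resample v zz yy i) (grid_dir v m zz) =
    dot (zz i) (grid_dir v m zz).
  by rewrite ffunE dot_setv// grid_dir_self.
have mgf := @score_mgf R p n pi (ising_pmf_ge0 M) (ising_pmf_sum M) v (th v)
  (cond_param_self M v) (ising_balance M v) V eps.
have {}mgf : esp pi (fun zz => expR (pairing (score zz v (th v)) (V zz)
    - expR eps / 2 * bil (hess zz (th v)) (V zz) (V zz))) <= 1.
  apply: mgf => [zz yy|zz|zz i].
  - rewrite /V grid_dir_resample//.
    by under eq_forallb do rewrite dotr.
  - by rewrite /V; case: ifP => _; [exact: grid_dir_self|rewrite mxE].
  - by rewrite /V; case: ifP => [/forallP//|_]; rewrite dot0 normr0 ltW.
apply: le_trans (exp_markov (ising_pmf_ge0 M) _ mgf).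
apply: prob_sub; first exact: ising_pmf_ge0.
by move=> zz [_ h1 h2]; rewrite /V; have -> := introT forallP h1.
Qed.

Definition node_fails (y : R) (v : 'I_p) (zz : sample) : Prop :=
  ((exists2 x, xpredT x & hess_dev v x zz) \/ (exists2 x, xpredT x & score_dev v x zz))
  \/ (exists2 m : grid, (0 < #|gdom m|)%N & grid_dev y v m zz).

(** Per node there are 2 p^2 + 2 p <= 4 p^2 entrywise deviations, and the grid. *)
Definition fail_bound (y : R) : R :=
  p%:R * (4 * p%:R ^+ 2 * expR (- (4 * L)) +
   (expR (p%:R * (expR (- y) * grid_const (eps * c))) - 1)).

Lemma node_fails_prob y v : prob pi (node_fails y v) <=
  4 * p%:R ^+ 2 * expR (- (4 * L)) + (expR (p%:R * (expR (- y) * grid_const (eps * c))) - 1).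
Proof.
have /andP[e0 _] := eps01; have /andP[c0 _] := curv_lower_bounds.
have pg := ising_pmf_ge0 M.
apply: le_trans (prob_or pg _ _) _; apply: lerD.
  apply: le_trans (prob_or pg _ _) _.
  have h1 : prob pi (fun zz : sample => exists2 x, xpredT x & hess_dev v x zz) <=
      2 * p%:R ^+ 2 * expR (- (4 * L)).
    apply: le_trans (prob_exists pg _ _) _.
    apply: (@le_trans _ _ (\sum_(x : 'I_p * 'I_p * bool) expR (- (4 * L)))).
      by apply: ler_sum => x _; exact: hess_dev_prob.
    rewrite sumr_const !card_prod card_bool card_ord -[leLHS]mulr_natl !natrM.
    by rewrite le_eqVlt; apply/orP; left; apply/eqP; ring.
  have h2 : prob pi (fun zz : sample => exists2 x, xpredT x & score_dev v x zz) <=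
      2 * p%:R * expR (- (4 * L)).
    apply: le_trans (prob_exists pg _ _) _.
    apply: (@le_trans _ _ (\sum_(x : 'I_p * bool) expR (- (4 * L)))).
      by apply: ler_sum => x _; exact: score_dev_prob.
    rewrite sumr_const !card_prod card_bool card_ord -[leLHS]mulr_natl !natrM.
    by rewrite le_eqVlt; apply/orP; left; apply/eqP; ring.
  have p1 : p%:R <= p%:R ^+ 2 :> R 
    by rewrite -natrX ler_nat -{1}[p]expn1 leq_pexp2l// (leq_ltn_trans (leq0n v) (ltn_ord v)).
  have := expR_gt0 (- (4 * L)) => E0.
  have : p%:R * expR (- (4 * L)) <= p%:R ^+ 2 * expR (- (4 * L)) by rewrite ler_pM2r.
  lra.
apply: le_trans (prob_exists pg _ _) _.
apply: le_trans (grid_mass p n y (mulr_gt0 e0 c0)).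
by apply: ler_sum => m _; exact: grid_dev_prob.
Qed.

Lemma selection_prob (y gamma r2 : R) :
  let X := ln N + 2 * gamma * ln p%:R in
  0 <= X -> (y + C) / (1 - 3 * eps) ^+ 2 + eps * L < X / 2 ->
  0 < r2 -> (forall v w, w \in ne M v -> r2 <= th v 0 w ^+ 2) ->
  2 * Q * r2 <= eps ^+ 2 -> 8 * 100 * Q * L <= c ^+ 2 * N * r2 ->
  Q * X < c / 4 * N * r2 ->
  1 - fail_bound y <=
  prob pi (fun zz : sample => forall v, is_unique_argmin zz q gamma v (ne M v)).
Proof.
move=> X X0 hX r20 hr2 re hr hQX.
have pg := ising_pmf_ge0 M.
rewrite lerBlDr -lerBlDl -(probC (ising_pmf_sum M)).
apply: (@le_trans _ _ (prob pi (fun zz : sample => exists2 v, xpredT v & node_fails y v zz))).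
  apply: prob_sub => // zz h; apply: contrapT => good; apply: h => v.
  have good_v : ~ node_fails y v zz by move=> bad; apply: good; exists v.
  have g1 : ~ (exists2 x, xpredT x & hess_dev v x zz) by move=> ?; apply: good_v; left; left.
  have g2 : ~ (exists2 x, xpredT x & score_dev v x zz) by move=> ?; apply: good_v; left; right.
  apply: (selection_deterministic n0 q0 L0 curv_lower_bounds curv_upper_ge1 eps01
    (@cond_param_supported R p M v) (ne_irr M v) (degree v) key (curvature_good g1) (score_good g2)
    (y := y) _ X0 hX r20 (hr2 v) re hr hQX).
  move=> m vm m0 V hV; rewrite leNgt; apply/negP => bad; apply: good_v; right.
  by exists m.
apply: le_trans (prob_exists pg _ _) _.
apply: le_trans (ler_sum _ (fun v _ => node_fails_prob y v)) _.
by rewrite sumr_const card_ord -[leLHS]mulr_natl.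
Qed.

End SelectionProbability.

(** * Transfer to the given probability spaces *)

Section FiniteValued.
Variables (R : realType) (d : measure_display) (T : measurableType d) (P : probability T R).
Variables (F : finType) (W : T -> F) (m : F -> R).
Hypothesis W_meas : forall z, measurable [set t | W t = z].
Hypothesis W_law : forall z, P [set t | W t = z] = (m z)%:E.

Lemma integral_finite (f : F -> R) : (forall z, 0 <= f z) ->
  (\int[P]_t (f (W t))%:E = (\sum_z m z * f z)%:E)%E.
Proof.
move=> f0.
have -> : (fun t => (f (W t))%:E) =
    (fun t => \sum_(z <- index_enum F) (f z)%:E * (\1_[set t | W t = z] t)%:E)%E.
  apply/funext => t; rewrite (bigD1_seq (W t)) ?mem_index_enum ?index_enum_uniq//=.
  rewrite indicE mem_set// mule1 big1 ?adde0// => z zW.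
  by rewrite indicE memNset ?mule0// => /= e; rewrite e eqxx in zW.
have mi z : measurable_fun setT (EFin \o (\1_[set t | W t = z] : T -> R)).
  by apply/measurable_EFinP; exact: measurable_indic.
rewrite ge0_integral_sum//.
- rewrite -sumEFin; apply: eq_bigr => z _.
  rewrite (ge0_integralZl P measurableT (mi z)) ?lee_fin//; last by move=> t _; rewrite lee_fin.
  by rewrite integral_indic// setIT EFinM muleC; congr (_ * _)%E; exact: W_law.
- by move=> z; apply: emeasurable_funM; [exact: measurable_cst|exact: mi].
- by move=> z t _; rewrite -EFinM lee_fin mulr_ge0.
Qed.

Lemma law_finite (A : F -> Prop) :
  (P [set t | A (W t)] = (\sum_(z | `[< A z >]) m z)%:E)%E.
Proof.
have E : [set t | A (W t)] = \bigcup_(z in [set z | A z]) [set t | W t = z].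
  by apply/seteqP; split=> [t At|t [z Az /= e]]; [exists (W t)|rewrite /= e].
have mE : measurable [set t | A (W t)].
  by rewrite E; apply: fin_bigcup_measurable => //; exact: finite_finset.
rewrite -[LHS](_ : P ([set t | A (W t)] `&` setT) = _); last by rewrite setIT.
rewrite -integral_indic//.
have := @integral_finite (fun z => if `[< A z >] then 1 else 0).
have h z : 0 <= (if `[< A z >] then 1 else 0) :> R by case: ifP.
move=> /(_ h) => e.
rewrite (_ : (fun t => _) = (fun t => (if `[< A (W t) >] then 1 else 0)%:E)).
  rewrite e [in RHS]big_mkcond; congr (_%:E); apply: eq_bigr => z _.
  by case: ifP => _; rewrite ?mulr1 ?mulr0.
apply/funext => t; rewrite indicE; congr ((_ : R)%:E).
case: ifPn => [/asboolP At|/asboolP At]; first by rewrite mem_set.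
by rewrite memNset.
Qed.

End FiniteValued.

Section Transfer.
Variables (R : realType) (d : measure_display) (T : measurableType d) (P : probability T R).
Variables (p n : nat) (M : ising_model R p) (Z : 'I_n -> T -> config p).
Hypothesis hZ : ising_sample M P Z.

Lemma expectation_sample (i : 'I_n) (f : config p -> R) : (forall c, 0 <= f c) ->
  ('E_P[(fun t => f (Z i t))%R] = (\sum_c ising_pmf M c * f c)%:E)%E.
Proof.
move=> f0; have [h1 h2 _] := hZ.
by rewrite unlock; exact: integral_finite.
Qed.

(** The product rule on singletons determines the joint mass function. *)
Lemma law_sample (A : {ffun 'I_n -> config p} -> Prop) :
  P [set t | A [ffun i => Z i t]] = (prob (ising_pmf M) A)%:E.
Proof.
have [h1 h2 h3] := hZ; apply: (law_finite (W := fun t => [ffun i => Z i t])) => zz.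
  have -> : [set t | [ffun i => Z i t] = zz] = \bigcap_(i in [set: 'I_n]) [set t | Z i t = zz i].
    apply/seteqP; split=> [t /= <- i _ /=|t h]; first by rewrite ffunE.
    by apply/ffunP => i; rewrite ffunE; exact: h.
  by apply: fin_bigcap_measurable => //; exact: finite_finset.
have := h3 (fun i => [set zz i]%SET).
have -> : [set t | forall i, Z i t \in [set zz i]%SET] = [set t | [ffun i => Z i t] = zz].
  apply/seteqP; split=> [t h|t /= <- i]; last by rewrite inE ffunE.
  by apply/ffunP => i; rewrite ffunE; have := h i; rewrite inE => /eqP.
move=> ->; rewrite /sprob -prodEFin; apply: eq_bigr => i _.
rewrite -(h2 i (zz i)); congr (P _); apply/seteqP; split=> [t|t] /=.
  by rewrite inE => /eqP.
by move=> ->; rewrite inE.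
Qed.

End Transfer.

(** * Growth comparisons and the exponent condition *)

Section Asymptotics.
Variable R : realType.

Lemma natr_powR (n : nat) (x : R) : (0 < n)%N -> n%:R `^ x = expR (x * ln n%:R).
Proof. by move=> n0; rewrite /powR pnatr_eq0 eqn0Ngt n0. Qed.

Lemma natr_expR_ln (n : nat) : (0 < n)%N -> n%:R = expR (ln n%:R) :> R.
Proof. by move=> n0; rewrite lnK// posrE ltr0n. Qed.

Lemma ln_natr_ge0 (n : nat) : (0 < n)%N -> 0 <= ln n%:R :> R.
Proof. by move=> n0; rewrite ln_ge0// ler1n. Qed.

Lemma near_ln (K : R) : \forall n \near \oo, K <= ln (n%:R : R).
Proof.
near=> n.
have n0 : (0 < n)%N by near: n; exact: nbhs_infty_gt.
rewrite -ler_expR -natr_expR_ln//.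
by near: n; exact: nbhs_infty_ger.
Unshelve. all: by end_near. Qed.

Lemma near_exp_dominates (K a b : R) : a < b ->
  \forall n \near \oo, K * expR (a * ln n%:R) <= expR (b * ln n%:R).
Proof.
move=> ab; have [m m0] : exists m : R, m = b - a by exists (b - a).
have mp : 0 < m by rewrite m0 subr_gt0.
near=> n.
have h : K / m <= ln n%:R by near: n; exact: near_ln.
have -> : b * ln n%:R = m * ln n%:R + a * ln n%:R by rewrite m0; ring.
rewrite expRD ler_pM2r ?expR_gt0//.
rewrite ler_pdivrMr// in h; rewrite mulrC (le_trans h)//.
by apply: le_trans (expR_ge1Dx _); rewrite mulrC lerDr.
Unshelve. all: by end_near. Qed.

Lemma near_exp_small (om e K : R) : 0 < om -> 0 < e ->
  \forall n \near \oo, K * expR (- (om * ln n%:R)) <= e.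
Proof.
move=> om0 e0; have := @near_exp_dominates (K / e) (- om) 0; rewrite oppr_lt0 => /(_ om0).
apply: filterS => n; rewrite mul0r expR0 mulNr mulrAC ler_pdivrMr// mul1r; exact.
Qed.

(** With l = log n and lp = log p, this makes p^2 e^(-(1 - dl) X / 2) at most n^(-om). The exponent
    is affine in lp, so for finite kappa the extreme cases are lp = 0 and lp = k l; at the latter,
    with dl = 0, it is negative exactly when gamma > 2 - 1 / (2 k). *)
Lemma exponent_margin (kappa : \bar R) (gamma : R) : (0 < kappa)%E -> 0 <= gamma ->
  2 - half_inv kappa < gamma ->
  exists dl om cX : R, [/\ 0 < dl < 1, 0 < om, 0 < cX &
   forall l lp : R, 0 <= l -> 0 <= lp -> (forall k : R, kappa = k%:E%E -> lp <= k * l) ->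
     2 * lp - (1 - dl) * ((l + 2 * gamma * lp) / 2) <= - (om * l) /\
     cX * (l + lp) <= l + 2 * gamma * lp].
Proof.
case: kappa => [k||]//=; last first.
  (* Here gamma > 2, and this dl cancels the coefficient of lp, leaving - l / gamma. *)
  rewrite subr0 => _ g0 g2; exists (1 - 2 / gamma), (1 / gamma), 1.
  have gp : 0 < gamma by lra.
  have h1 : 2 / gamma < 1 by rewrite ltr_pdivrMr// mul1r.
  have h2 : 0 < 2 / gamma by rewrite divr_gt0.
  split; [lra|by rewrite divr_gt0|by []|move=> l lp l0 lp0 _]; split.
    rewrite le_eqVlt; apply/orP; left; apply/eqP; field; lra.
  have : 1 * lp <= 2 * gamma * lp by rewrite ler_wpM2r//; lra.
  lra.
rewrite lte_fin => k0 g0 hg.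
have D0 : 0 < gamma * k + 1 / 2 - 2 * k.
  have : (2 - (2 * k)^-1) * k < gamma * k by rewrite ltr_pM2r.
  have -> : (2 - (2 * k)^-1) * k = 2 * k - 1 / 2 by field; lra.
  lra.
set D := gamma * k + 1 / 2 - 2 * k in D0.
have gk0 : 0 <= gamma * k by rewrite mulr_ge0// ltW.
pose e := gamma * k + 1 / 2; have e0 : 0 < e by rewrite /e; lra.
have De : D < 2 * e by rewrite /D /e; lra.
(* Gives up half of the margin D. *)
pose dl := D / (2 * e).
have dl0 : 0 < dl by rewrite divr_gt0// mulr_gt0.
have dl1 : dl < 1 by rewrite /dl ltr_pdivrMr ?mul1r// mulr_gt0.
have dle : dl * e = D / 2 by rewrite /dl; field; lra.
exists dl, (Num.min ((1 - dl) / 2) (D / 2)), (1 + k)^-1; split.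
- by rewrite dl0 dl1.
- by rewrite lt_min; apply/andP; split; lra.
- by rewrite invr_gt0; lra.
move=> l lp l0 lp0 /(_ k erefl) hlp; split; last first.
  rewrite mulrC ler_pdivrMr; last by lra.
  apply: (@le_trans _ _ (l * (1 + k))); first by lra.
  by rewrite ler_wpM2r//; [lra|rewrite lerDl !mulr_ge0].
set om := Num.min _ _.
have om1 : om <= (1 - dl) / 2 by rewrite ge_min lexx.
have om2 : om <= D / 2 by rewrite ge_min lexx orbT.
have [g|g] := lerP (2 - (1 - dl) * gamma) 0.
  have : (2 - (1 - dl) * gamma) * lp <= 0 by rewrite mulr_le0_ge0.
  have : om * l <= (1 - dl) / 2 * l by rewrite ler_wpM2r.
  lra.
have : (2 - (1 - dl) * gamma) * lp <= (2 - (1 - dl) * gamma) * (k * l) by rewrite ler_pM2l.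
have : om * l <= D / 2 * l by rewrite ler_wpM2r.
have : (2 - (1 - dl) * gamma) * (k * l) - (1 - dl) / 2 * l = - (D / 2) * l.
  have -> : (2 - (1 - dl) * gamma) * (k * l) - (1 - dl) / 2 * l = (2 * k - e + dl * e) * l.
    by rewrite /e; field.
  by rewrite dle /e /D; field.
lra.
Qed.

(** p^3 e^(-4 L) <= 1 / n, and e^x - 1 <= 2 x on [0, 1/2] turns the grid term into 2 G p^2
    e^(-y). *)
Lemma fail_bound_le (p n : nat) (b0 b1 b2 eps y om : R) : (0 < n)%N -> (0 < p)%N ->
  let G := grid_const (eps * curv_lower b0 b1 b2) in
  0 <= G -> 2 * ln p%:R - y <= - (om * ln n%:R) -> G * expR (- (om * ln n%:R)) <= 1 / 2 ->
  fail_bound p b0 b1 b2 (ln n%:R + ln p%:R) eps y <=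
  4 * expR (- (1 * ln n%:R)) + 2 * G * expR (- (om * ln n%:R)).
Proof.
move=> n0 p0 G G0 hy hG; rewrite /fail_bound -/G.
set l := ln n%:R in hy hG *; set lp := ln p%:R in hy *.
have l0 : 0 <= l by exact: ln_natr_ge0.
have lp0 : 0 <= lp by exact: ln_natr_ge0.
have pE : p%:R = expR lp :> R by exact: natr_expR_ln.
have p1 : 1 <= expR lp by rewrite -expR0 ler_expR.
rewrite mulrDr; apply: lerD.
  have -> : p%:R * (4 * p%:R ^+ 2 * expR (- (4 * (l + lp)))) =
     4 * (expR lp * (expR lp * expR lp) * expR (- (4 * (l + lp)))) by rewrite pE; ring.
  rewrite -!expRD ler_pM2l// ler_expR; lra.
have h1 : expR lp * expR (- y) <= expR lp * (expR lp * expR (- y)).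
  by rewrite ler_peMl// mulr_ge0 ?expR_ge0.
have h2 : expR lp * (expR lp * expR (- y)) <= expR (- (om * l)).
  by rewrite -!expRD ler_expR; lra.
set x := p%:R * (expR (- y) * G).
have x0 : 0 <= x by rewrite mulr_ge0 ?ler0n// mulr_ge0 ?expR_ge0.
have xE : x = G * (expR lp * expR (- y)) by rewrite /x pE; ring.
have x1 : x <= 1 / 2.
  by apply: le_trans hG; rewrite xE ler_wpM2l// (le_trans h1 h2).
have h3 : expR x - 1 <= 2 * x by apply: expR_sub1_le; rewrite x0.
apply: (@le_trans _ _ (expR lp * (2 * x))); first by rewrite pE ler_pM2l ?expR_gt0.
have -> : expR lp * (2 * x) = 2 * G * (expR lp * (expR lp * expR (- y))) by rewrite xE; ring.
by rewrite ler_wpM2l// mulr_ge0.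
Qed.

End Asymptotics.

(** The level (1 - dl) X / 2 frees dl X / 2: half of it absorbs the losses in eps, the other half
    the constant C. *)
Lemma numeric_penalty (R : realFieldType) (eps dl cX C L X : R) :
  0 < eps <= 1 / 8 -> 0 < dl -> 0 < cX -> eps * (6 + 2 / cX) <= dl / 2 -> cX * L <= X ->
  0 < L -> 4 * C / dl < X ->
  ((1 - dl) * (X / 2) + C) / (1 - 3 * eps) ^+ 2 + eps * L < X / 2.
Proof.
move=> /andP[e0 e1] dl0 cX0 he hL L0 hC.
have X0 : 0 < X by apply: lt_le_trans hL; exact: mulr_gt0.
set s := (1 - 3 * eps) ^+ 2.
have s1 : 1 - 6 * eps <= s by rewrite /s; have := sqr_ge0 eps; lra.
have s2 : s <= 1 by rewrite /s expr_le1//; lra.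
have s0 : 0 < s by rewrite /s exprn_gt0; lra.
rewrite -(ltr_pM2r s0) mulrDl divfK ?gt_eqF//.
have h1 : eps * L * s <= eps * L by rewrite ler_piMr// mulr_ge0// ltW.
have h2 : eps * L <= eps * (X / cX) by rewrite ler_pM2l// ler_pdivlMr// mulrC.
have h3 : eps * (6 + 2 / cX) * X <= dl / 2 * X by rewrite ler_pM2r.
have h4 : (1 - 6 * eps) * X <= s * X by rewrite ler_pM2r.
have h5 : 4 * C < X * dl by rewrite -ltr_pdivrMr.
have h6 : eps * (6 + 2 / cX) * X = 6 * eps * X + 2 * (eps * (X / cX)) by ring.
lra.
Qed.

Lemma numeric_radius_le (R : realFieldType) (A B N Q eps r1 : R) :
  0 <= A -> 0 < Q -> 0 < N -> 0 < B ->
  A <= B * (N * r1) -> 2 * Q * A <= B * (eps ^+ 2 * N) ->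
  A <= B * N * Num.min r1 (eps ^+ 2 / (2 * Q)).
Proof.
move=> A0 Q0 N0 B0 h1 h2; rewrite /Num.min; case: ifP => _; first by rewrite -mulrA.
rewrite mulrA ler_pdivlMr ?mulr_gt0//; rewrite mulrC in h2.
by apply: le_trans h2 _; rewrite le_eqVlt; apply/orP; left; apply/eqP; ring.
Qed.

Lemma prob_le1 (R : realType) (p n : nat) (pi : config p -> R)
  (A : {ffun 'I_n -> config p} -> Prop) :
  (forall c, 0 <= pi c) -> \sum_c pi c = 1 -> prob pi A <= 1.
Proof.
move=> pi0 pi1; rewrite -subr_ge0 -probC//; apply: sumr_ge0 => zz _.
exact: sprob_ge0.
Qed.

(** * From the assumptions at one sample size to the failure bound *)

Section OneSampleSize.
Variables (R : realType) (d : measure_display) (T : measurableType d) (P : probability T R).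
Variables (p n q : nat) (M : ising_model R p) (Z : 'I_n -> T -> config p).
Variables (b0 b1 b2 thr : R).
Hypothesis n0 : (0 < n)%N.
Hypothesis b00 : 0 < b0.
Hypothesis b10 : 0 < b1.
Hypothesis b20 : 0 < b2.
Hypothesis hZ : ising_sample M P Z.
Hypothesis B1 : forall v, Num.sqrt (\sum_(w in ne M v) inter M v w ^+ 2) <= b0.
Hypothesis B2 : forall u : 'rV[R]_p, sparse (2 * q) u -> euclidean_norm u = 1 ->
  (b1%:E <= 'E_P[(fun t : T => dot (Z (Ordinal n0) t) u ^+ 2)%R])%E.
Hypothesis B3 : forall u : 'rV[R]_p, sparse (2 * q) u -> euclidean_norm u = 1 ->
  ('E_P[(fun t : T => `|dot (Z (Ordinal n0) t) u| ^+ 3)%R] <= b2%:E)%E.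

Lemma sparse_supported J (u : 'rV[R]_p) : supported J u -> (#|J| <= 2 * q)%N ->
  sparse (2 * q) u.
Proof.
move=> su Jq; rewrite /sparse (leq_trans _ Jq)// subset_leq_card//.
apply/fintype.subsetP => w; rewrite inE; apply: contraR => /su ->.
by rewrite eqxx.
Qed.

Lemma euclidean_sqn (u : 'rV[R]_p) : sqn u = 1 -> euclidean_norm u = 1.
Proof. by move=> h; rewrite /euclidean_norm -/(sqn u) h sqrtr1. Qed.

Lemma second_moment J (u : 'rV[R]_p) : supported J u -> (#|J| <= 2 * q)%N ->
  sqn u = 1 -> b1 <= \sum_c ising_pmf M c * dot c u ^+ 2.
Proof.
move=> su Jq /euclidean_sqn nu; have := B2 (sparse_supported su Jq) nu.
have f0 (c : config p) : 0 <= dot c u ^+ 2 by exact: sqr_ge0.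
by rewrite (expectation_sample hZ _ f0) lee_fin.
Qed.

Lemma third_moment J (u : 'rV[R]_p) : supported J u -> (#|J| <= 2 * q)%N ->
  sqn u = 1 -> \sum_c ising_pmf M c * `|dot c u| ^+ 3 <= b2.
Proof.
move=> su Jq /euclidean_sqn nu; have := B3 (sparse_supported su Jq) nu.
have f0 (c : config p) : 0 <= `|dot c u| ^+ 3 by exact: exprn_ge0.
by rewrite (expectation_sample hZ _ f0) lee_fin.
Qed.

Lemma cond_param_norm v : sqn (cond_param M v) <= (2 * b0) ^+ 2.
Proof.
rewrite /sqn (supported_sum (F := fun=> fun x => x ^+ 2) (@cond_param_supported _ _ M v)); last first.
  by move=> j; rewrite expr0n.
have -> : \sum_(w in ne M v) cond_param M v 0 w ^+ 2 =
    4 * \sum_(w in ne M v) inter M v w ^+ 2.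
  by rewrite mulr_sumr; apply: eq_bigr => w wv; rewrite mxE wv; ring.
have s0 : 0 <= \sum_(w in ne M v) inter M v w ^+ 2.
  by apply: sumr_ge0 => w _; exact: sqr_ge0.
have := B1 v; rewrite -(@ler_sqr _ (Num.sqrt _)) ?nnegrE ?sqrtr_ge0 ?(ltW b00)//.
by rewrite sqr_sqrtr//; lra.
Qed.

Lemma theta_min_le v w : (thr%:E <= theta_min M)%E -> w \in ne M v ->
  thr <= `|inter M v w|.
Proof.
move=> h wv; rewrite -lee_fin (le_trans h)// /theta_min.
rewrite inE in wv.
exact: (bigmin_le_cond (j := (v, w)) _ (fun e => `|inter M e.1 e.2|%:E)).
Qed.

Lemma cond_param_large v w : 0 <= thr -> (thr%:E <= theta_min M)%E -> w \in ne M v ->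
  thr ^+ 2 <= cond_param M v 0 w ^+ 2.
Proof.
move=> t0 h wv; have h1 := theta_min_le h wv; rewrite mxE wv exprMn.
have : thr ^+ 2 <= inter M v w ^+ 2.
  by rewrite -[leRHS]real_normK ?num_real// ler_sqr ?nnegrE.
have := sqr_ge0 (inter M v w); lra.
Qed.

Lemma selection_law (k : nat) (gamma : R) :
  P [set t : T | forall v, is_unique_argmin (fun i => Z i t) k gamma v (ne M v)] =
  (prob (ising_pmf M) (fun zz : {ffun 'I_n -> config p} =>
     forall v, is_unique_argmin zz k gamma v (ne M v)))%:E.
Proof.
pose A (z : 'I_n -> config p) : Prop := forall v, is_unique_argmin z k gamma v (ne M v).
have -> : [set t : T | forall v, is_unique_argmin (fun i => Z i t) k gamma v (ne M v)] =
    [set t | A ([ffun i => Z i t] : {ffun 'I_n -> config p})].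
  apply/funext => t; rewrite -[LHS]/(A (fun i => Z i t)) -[RHS]/(A _); congr A.
  by apply/funext => i; rewrite ffunE.
exact: (law_sample hZ (fun zz => A zz)).
Qed.

(** The first growth condition is [key]. The next two handle the case where [r2] is its cap, the
    last two the case where it is [thr ^+ 2]; each pair covers score noise and penalty. *)
Lemma one_sample_bound (eps dl cX gamma : R) :
  let l := ln n%:R in let lp := ln p%:R in let L := l + lp in
  let X := l + 2 * gamma * lp in
  let c := curv_lower b0 b1 b2 in let C := curv_upper b2 in
  let N : R := n%:R in let Q : R := q%:R in
  0 < eps <= 1 / 8 -> 0 < dl -> 0 < cX -> eps * (6 + 2 / cX) <= dl / 2 ->
  0 <= gamma -> (0 < q)%N -> (max_degree M <= q)%N -> 0 <= l -> 0 <= lp -> 0 < L ->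
  0 < thr -> (thr%:E <= theta_min M)%E ->
  cX * L <= X -> 4 * C / dl < X ->
  100 * 100 * C / (eps ^+ 2 * c ^+ 3) * (Q ^+ 3 * L) <= N ->
  2 * (8 * 100) / (c ^+ 2 * eps ^+ 2) * (Q ^+ 3 * L) <= N ->
  2 * (8 * (1 + 2 * gamma)) / (c * eps ^+ 2) * (Q ^+ 3 * L) <= N ->
  8 * 100 / c ^+ 2 * (Q * L) <= N * thr ^+ 2 ->
  8 * (1 + 2 * gamma) / c * (Q * L) <= N * thr ^+ 2 ->
  1 - fail_bound p b0 b1 b2 L eps ((1 - dl) * (X / 2)) <=
  prob (ising_pmf M) (fun zz : {ffun 'I_n -> config p} =>
    forall v, is_unique_argmin zz q gamma v (ne M v)).
Proof.
move=> l lp L X c C N Q eps01 dl0 cX0 he g0 q0 hd l0 lp0 L0 thr0 hthr hX1 hX2 k1 k2 k3 k4 k5.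
have /andP[c0 c1] : 0 < c <= 1 by exact: curv_lower_bounds.
have e0 : 0 < eps by case/andP: eps01.
have N0 : 0 < N by rewrite ltr0n.
have Q1 : 1 <= Q by rewrite ler1n.
have Q0 : 0 < Q by exact: lt_le_trans Q1.
have QL0 : 0 <= Q * L by rewrite mulr_ge0 ?(ltW Q0) ?(ltW L0).
have Q23 : Q * (Q * L) <= Q ^+ 3 * L.
  by rewrite mulrA (ler_pM2r L0) -expr2; exact: ler_weXn2l.
have gam : 0 <= 8 * (1 + 2 * gamma) by rewrite mulr_ge0// addr_ge0// mulr_ge0.
have ce0 : 0 < eps ^+ 2 * c ^+ 3 by rewrite mulr_gt0// exprn_gt0.
have key : 100 * 100 * C * Q ^+ 3 * L <= eps ^+ 2 * c ^+ 3 * N.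
  move: k1; rewrite mulrAC ler_pdivrMr// [N * _]mulrC; apply: le_trans.
  by rewrite !mulrA.
(* The cap keeps the predictors along a step of squared length r2 below eps. *)
pose r2 := Num.min (thr ^+ 2) (eps ^+ 2 / (2 * Q)).
have t2 : 0 < thr ^+ 2 by rewrite exprn_gt0.
have r20 : 0 < r2 by rewrite lt_min t2 divr_gt0 ?exprn_gt0// mulr_gt0.
have scaled (B K : R) : 0 < B -> 0 <= K -> K / B * (Q * L) <= N * thr ^+ 2 ->
    2 * K / (B * eps ^+ 2) * (Q ^+ 3 * L) <= N -> K * (Q * L) <= B * N * r2.
  move=> B0 K0 h1 h2; apply: numeric_radius_le => //.
  - by rewrite mulr_ge0.
  - by rewrite mulrAC ler_pdivrMr// [_ * B]mulrC in h1.
  - have Be : 0 < B * eps ^+ 2 by rewrite mulr_gt0// exprn_gt0.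
    rewrite mulrAC ler_pdivrMr// in h2.
    have -> : B * (eps ^+ 2 * N) = N * (B * eps ^+ 2) by ring.
    apply: le_trans h2.
    have -> : 2 * Q * (K * (Q * L)) = 2 * K * (Q * (Q * L)) by ring.
    by rewrite ler_wpM2l// mulr_ge0.
have hr : 8 * 100 * Q * L <= c ^+ 2 * N * r2.
  by rewrite -mulrA; apply: scaled => //; rewrite exprn_gt0.
have hXL : X <= (1 + 2 * gamma) * L.
  have h : 0 <= 2 * gamma * l by rewrite mulr_ge0// mulr_ge0.
  by rewrite /X /L; lra.
have hQX : Q * X < c / 4 * N * r2.
  (* The factor 8, twice what is required, yields the strict inequality. *)
  have h := scaled c _ c0 gam k5 k3.
  have h1 : Q * X <= Q * ((1 + 2 * gamma) * L) by rewrite ler_pM2l.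
  have h2 : 0 < c * N * r2 by rewrite mulr_gt0 ?(mulr_gt0 c0 N0).
  lra.
have deg v : (#|ne M v| <= q)%N by apply: leq_trans hd; exact: (leq_bigmax v).
have sp := selection_prob n0 q0 L0 b00 b10 b20 eps01 deg cond_param_norm
  second_moment third_moment key.
apply: (sp ((1 - dl) * (X / 2)) gamma r2) => //.
- by rewrite addr_ge0// mulr_ge0// mulr_ge0.
- by apply: numeric_penalty eps01 dl0 cX0 he hX1 L0 hX2.
- move=> v w wv; apply: (@le_trans _ _ (thr ^+ 2)); first by rewrite ge_min lexx.
  exact: cond_param_large (ltW thr0) hthr wv.
- rewrite mulrC -ler_pdivlMr ?mulr_gt0//; by rewrite ge_min lexx orbT.
Qed.

End OneSampleSize.

Theorem theorem3p1 (R : realType)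
    (d : nat -> measure_display) (T : forall n : nat, measurableType (d n))
    (P : forall n : nat, probability (T n) R)
    (p q : nat -> nat) (M : forall n : nat, ising_model R (p n))
    (Z : forall n : nat, 'I_n -> T n -> config (p n))
    (kappa : \bar R) (tau psi phi b0 b1 b2 gamma : R)
    (hZ : forall n : nat, (0 < n)%N -> ising_sample (M n) (P n) (Z n))
    (hq1 : forall n : nat, (0 < n)%N -> (1 <= q n)%N)
    (hp : p @ \oo --> \oo)
    (hkappa : (0 < kappa)%E)
    (hpkappa : forall n : nat, (0 < n)%N ->
       (((p n)%:R : R)%:E <= ext_powR (n%:R : R) kappa)%E)
    (htau : 0 < tau < 1)
    (hptau : forall n : nat, (0 < n)%N -> ln (p n)%:R <= n%:R `^ tau)
    (hpsi : 0 <= psi < (1 - tau) / 3)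
    (hqpsi : forall n : nat, (0 < n)%N -> (q n)%:R <= n%:R `^ psi)
    (hphi : 0 <= phi < 1 - psi - tau)
    (hthetamin : forall n : nat, (0 < n)%N ->
       ((n%:R `^ (- phi / 2))%:E <= theta_min (M n))%E)
    (hdq : forall n : nat, (0 < n)%N -> (max_degree (M n) <= q n)%N)
    (hb0 : 0 < b0) (hb1 : 0 < b1) (hb2 : 0 < b2)
    (B1 : forall (n : nat) (v : 'I_(p n)), (0 < n)%N ->
       Num.sqrt (\sum_(w in ne (M n) v) inter (M n) v w ^+ 2) <= b0)
    (B2 : forall (n : nat) (n0 : (0 < n)%N) (u : 'rV[R]_(p n)),
       sparse (2 * q n) u -> euclidean_norm u = 1 ->
       (b1%:E <=
         'E_(P n)[(fun t : T n => dot (Z n (Ordinal n0) t) u ^+ 2)%R])%E)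
    (B3 : forall (n : nat) (n0 : (0 < n)%N) (u : 'rV[R]_(p n)),
       sparse (2 * q n) u -> euclidean_norm u = 1 ->
       ('E_(P n)[(fun t : T n => `|dot (Z n (Ordinal n0) t) u| ^+ 3)%R] <=
         b2%:E)%E)
    (hgamma0 : 0 <= gamma)
    (hgamma : 2 - half_inv kappa < gamma) :
  (fun n : nat => P n [set t : T n | forall v : 'I_(p n),
      is_unique_argmin (fun i : 'I_n => Z n i t) (q n) gamma v (ne (M n) v)])
    @ \oo --> (1 : \bar R)%E.
Proof.
have [dl [om [cX [/andP[dl0 dl1] om0 cX0 margin]]]] :=
  exponent_margin hkappa hgamma0 hgamma.
have /andP[tau0 tau1] := htau; have /andP[psi0 psi1] := hpsi.
have /andP[phi0 phi1] := hphi.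
pose c := curv_lower b0 b1 b2; pose C := curv_upper b2.
have /andP[c0 c1] : 0 < c <= 1 by exact: curv_lower_bounds.
have C1 : 1 <= C by exact: curv_upper_ge1.
pose eps := Num.min (1 / 8) (dl / 2 / (6 + 2 / cX)).
have cX2 : 0 < 6 + 2 / cX by rewrite addr_gt0// divr_gt0.
have e0 : 0 < eps by rewrite lt_min !divr_gt0.
have e1 : eps <= 1 / 8 by rewrite ge_min lexx.
have eps01 : 0 < eps <= 1 / 8 by rewrite e0.
have e2 : eps * (6 + 2 / cX) <= dl / 2 by rewrite -ler_pdivlMr// ge_min lexx orbT.
pose l n : R := ln n%:R; pose lp n : R := ln (p n)%:R.
pose L n := l n + lp n; pose Q n : R := (q n)%:R.
have near_p : \forall n \near \oo, (0 < p n)%N by exact: (hp _ (nbhs_infty_gt 0)).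
(* log n <= n^tau / tau, so both parts of L are of order n^tau. *)
have Lexp n : (0 < n)%N -> L n <= (1 + tau^-1) * expR (tau * l n).
  move=> n0; have := hptau n n0; rewrite natr_powR// -/(l n) -/(lp n) => h.
  have h1 : l n <= tau^-1 * expR (tau * l n).
    by rewrite ler_pdivlMl//; have := expR_ge1Dx (tau * l n); lra.
  rewrite /L; lra.
have Qexp n : (0 < n)%N -> Q n <= expR (psi * l n).
  by move=> n0; rewrite -natr_powR//; exact: hqpsi.
have lead0 : 0 < 1 + tau^-1 :> R by rewrite addr_gt0// invr_gt0.
(* Here 3 psi + tau < 1 enters. *)
have dominate_N (K : R) : 0 <= K -> \forall n \near \oo, K * (Q n ^+ 3 * L n) <= n%:R.
  move=> K0; near=> n.
  have n0 : (0 < n)%N by near: n; exact: nbhs_infty_gt.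
  have : K * (1 + tau^-1) * expR ((3 * psi + tau) * l n) <= expR (1 * l n).
    by near: n; apply: near_exp_dominates; lra.
  rewrite mul1r /l -natr_expR_ln//; apply: le_trans.
  rewrite -mulrA ler_wpM2l// [(3 * psi + tau) * _]mulrDl expRD -/(l n).
  have -> : (1 + tau^-1) * (expR (3 * psi * l n) * expR (tau * l n)) =
    expR (psi * l n) ^+ 3 * ((1 + tau^-1) * expR (tau * l n)).
    by rewrite -expRM_natl (_ : 3%:R * (psi * l n) = 3 * psi * l n); ring.
  apply: (@le_trans _ _ (Q n ^+ 3 * ((1 + tau^-1) * expR (tau * l n)))).
    by rewrite ler_wpM2l ?exprn_ge0 ?ler0n// Lexp.
  rewrite ler_wpM2r ?mulr_ge0 ?expR_ge0 ?(ltW lead0)//.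
  by rewrite lerXn2r ?nnegrE ?ler0n ?expR_ge0// Qexp.
(* Here psi + tau < 1 - phi enters; n^(-phi) is the square of the lower bound on theta_min. *)
have dominate_phi (K : R) : 0 <= K ->
    \forall n \near \oo, K * (Q n * L n) <= n%:R * expR (- (phi * l n)).
  move=> K0; near=> n.
  have n0 : (0 < n)%N by near: n; exact: nbhs_infty_gt.
  have : K * (1 + tau^-1) * expR ((psi + tau) * l n) <= expR ((1 - phi) * l n).
    by near: n; apply: near_exp_dominates; lra.
  rewrite [(1 - phi) * _]mulrBl mul1r expRD /l -natr_expR_ln//; apply: le_trans.
  rewrite -mulrA ler_wpM2l// [(psi + tau) * _]mulrDl expRD -/(l n).
  have -> : (1 + tau^-1) * (expR (psi * l n) * expR (tau * l n)) =
    expR (psi * l n) * ((1 + tau^-1) * expR (tau * l n)) by ring.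
  apply: (@le_trans _ _ (Q n * ((1 + tau^-1) * expR (tau * l n)))).
    by rewrite ler_wpM2l ?ler0n// Lexp.
  by rewrite ler_wpM2r ?mulr_ge0 ?expR_ge0 ?(ltW lead0)// Qexp.
pose G := grid_const (eps * c).
have G0 : 0 <= G by apply: grid_const_ge0; exact: mulr_gt0.
have gam1 : 0 <= 1 + 2 * gamma by rewrite addr_ge0// mulr_ge0.
pose pr n : R := prob (ising_pmf (M n)) (fun zz : {ffun 'I_n -> config (p n)} =>
  forall v, is_unique_argmin zz (q n) gamma v (ne (M n) v)).
have law n (n0 : (0 < n)%N) : P n [set t : T n | forall v : 'I_(p n),
      is_unique_argmin (fun i : 'I_n => Z n i t) (q n) gamma v (ne (M n) v)] =
    (pr n)%:E.
  exact: selection_law (hZ n n0) _ _.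
have lower : \forall n \near \oo,
    1 - (4 * expR (- (1 * l n)) + 2 * G * expR (- (om * l n))) <= pr n.
  pose K1 := 100 * 100 * C / (eps ^+ 2 * c ^+ 3).
  pose K2 := 2 * (8 * 100) / (c ^+ 2 * eps ^+ 2).
  pose K3 := 2 * (8 * (1 + 2 * gamma)) / (c * eps ^+ 2).
  pose K4 := 8 * 100 / c ^+ 2.
  pose K5 := 8 * (1 + 2 * gamma) / c.
  have C0 : 0 <= C by exact: le_trans C1.
  have K1_0 : 0 <= K1 by rewrite divr_ge0// mulr_ge0// exprn_ge0// ltW.
  have K2_0 : 0 <= K2 by rewrite divr_ge0// mulr_ge0// exprn_ge0// ltW.
  have K3_0 : 0 <= K3.
    by rewrite divr_ge0//; [do 2 rewrite mulr_ge0//|rewrite mulr_ge0 ?exprn_ge0// ltW].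
  have K4_0 : 0 <= K4 by rewrite divr_ge0// exprn_ge0// ltW.
  have K5_0 : 0 <= K5 by rewrite divr_ge0 ?(ltW c0)// mulr_ge0.
  near=> n.
  have n0 : (0 < n)%N by near: n; exact: nbhs_infty_gt.
  have p0 : (0 < p n)%N by near: n.
  have l1 : 4 * C / dl + 1 <= l n by near: n; exact: near_ln.
  have lC : 0 <= 4 * C / dl by rewrite divr_ge0 ?mulr_ge0 ?(ltW dl0).
  have lgt0 : 0 < l n by apply: lt_le_trans l1; exact: ltr_wpDl.
  have lp0 : 0 <= lp n by exact: ln_natr_ge0.
  have L0 : 0 < L n by exact: ltr_wpDr.
  have gl : 0 <= 2 * gamma * lp n by rewrite !mulr_ge0.
  have hkl (k : R) : kappa = k%:E%E -> lp n <= k * l n.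
    move=> kE; have := hpkappa n n0; rewrite kE /= lee_fin natr_powR// => h.
    by rewrite -ler_expR -natr_expR_ln.
  have [m1 m2] := margin (l n) (lp n) (ltW lgt0) lp0 hkl.
  have hX2 : 4 * C / dl < l n + 2 * gamma * lp n.
    by apply: (@lt_le_trans _ _ (4 * C / dl + 1)); rewrite ?ltrDl// (le_trans l1)// lerDl.
  have hG : G * expR (- (om * l n)) <= 1 / 2.
    by near: n; apply: near_exp_small => //; rewrite divr_gt0.
  have hthr : ((expR (- phi / 2 * l n))%:E <= theta_min (M n))%E.
    by rewrite -natr_powR//; exact: hthetamin.
  have thr2 : expR (- phi / 2 * l n) ^+ 2 = expR (- (phi * l n)).
    by rewrite expr2 -expRD; congr expR; field.
  have k1 : K1 * (Q n ^+ 3 * L n) <= n%:R by near: n; exact: dominate_N.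
  have k2 : K2 * (Q n ^+ 3 * L n) <= n%:R by near: n; exact: dominate_N.
  have k3 : K3 * (Q n ^+ 3 * L n) <= n%:R by near: n; exact: dominate_N.
  have k4 : K4 * (Q n * L n) <= n%:R * expR (- phi / 2 * l n) ^+ 2.
    by rewrite thr2; near: n; exact: dominate_phi.
  have k5 : K5 * (Q n * L n) <= n%:R * expR (- phi / 2 * l n) ^+ 2.
    by rewrite thr2; near: n; exact: dominate_phi.
  have hfail := fail_bound_le n0 p0 G0 m1 hG.
  have hone := one_sample_bound hb0 hb1 hb2 (hZ n n0) (fun v => B1 n v n0) (B2 n n0) (B3 n n0)
    eps01 dl0 cX0 e2 hgamma0 (hq1 n n0) (hdq n n0) (ltW lgt0) lp0 L0 (expR_gt0 _) hthr
    m2 hX2 k1 k2 k3 k4 k5.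
  by apply: le_trans hone; rewrite lerD2l lerN2.
apply/fine_cvgP; split.
  by near=> n; rewrite law//; near: n; exact: nbhs_infty_gt.
apply/cvgrPdist_le => e e_gt0; near=> n.
have n0 : (0 < n)%N by near: n; exact: nbhs_infty_gt.
rewrite /= law//=.
have h1 : 4 * expR (- (1 * l n)) <= e / 2 by near: n; apply: near_exp_small; rewrite ?divr_gt0.
have h2 : 2 * G * expR (- (om * l n)) <= e / 2.
  by near: n; apply: near_exp_small; rewrite ?divr_gt0.
have h3 : 1 - (4 * expR (- (1 * l n)) + 2 * G * expR (- (om * l n))) <= pr n by near: n.
have h4 : pr n <= 1 by apply: prob_le1; [exact: ising_pmf_ge0|exact: ising_pmf_sum].
rewrite ger0_norm ?subr_ge0// lerBlDr -lerBlDl; apply: le_trans h3.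
by rewrite lerD2l lerN2 [leRHS]splitr lerD.
Unshelve. all: by end_near. Qed.
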